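(* Let $j,r\ge 0$ and $k\ge 1$ be integers with $j+r\le k$. Then \[ \sum_{s_1\ge\cdots\ge s_k\ge 0} q^{s_1^2+\cdots+s_k^2+\sum_{i=k-r+1}^{k}s_i+s_k}\cdot\frac{q^{-s_1-\cdots-s_j}\prod_{i=2}^{j}(1+q^{s_{i-1}+s_i})}{(q)_{s_1-s_2}\cdots(q)_{s_{k-1}-s_k}(q^2;q^2)_{s_k}} =\frac{1}{1+q}\sum_{s=0}^{j}\binom{j}{s}\left(\frac{(q^{2k+2},q^{k+2-r+j-2s},q^{k+r-j+2s};q^{2k+2})_\infty}{(q)_\infty}+q\,\frac{(q^{2k+2},q^{k-r+j-2s},q^{k+2+r-j+2s};q^{2k+2})_\infty}{(q)_\infty}\right). \] (The exponent $\sum_{i=k-r+1}^k s_i+s_k$ is the paper's $s_{k-r+1}+\cdots+s_{k-1}+2s_k$.) Moreover, the $j$ factors $q^{-s_1}$ and $q^{-s_i}(1+q^{s_{i-1}+s_i})$, $2\le i\le j$, on the left-hand side may be replaced by any $j$-element subset of $\{q^{-s_1}\}\cup\{q^{-s_i}(1+q^{s_{i-1}+s_i}) : 2\le i\le k-r\}$, and the identity still holds.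
   Context: $q$ is a complex number with $|q|<1$. $(a;q)_\infty=\prod_{m\ge0}(1-aq^m)$, $(a;q)_n=(a;q)_\infty/(aq^n;q)_\infty$, $(a)_n=(a;q)_n$, $(a_1,\dots,a_m;q)_n=(a_1;q)_n\cdots(a_m;q)_n$. Empty products equal $1$ and empty sums equal $0$; $\binom{j}{s}$ is the ordinary binomial coefficient. *)

(* Defs.v *)
From mathcomp Require Import all_boot all_order all_algebra finmap.
From mathcomp Require Import all_classical all_reals all_analysis.
From mathcomp Require Import complex.
From mathcomp.analysis Require Import summability.

Set Implicit Arguments.
Unset Strict Implicit.
Unset Printing Implicit Defensive.

Import Order.TTheory GRing.Theory Num.Theory.
Import numFieldNormedType.Exports.

Local Open Scope classical_set_scope.
Local Open Scope ring_scope.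

(* The definitions below are stated over a numFieldType K, which carries the
   topology of its norm; they are used with K = R[i]. *)

(* (a; q)_oo *)
Definition qpoch_inf (K : numFieldType) (a q : K) : K :=
  limn (fun n => \prod_(0 <= m < n) (1 - a * q ^+ m)).

(* (a_1, ..., a_m; q)_oo *)
Definition qpochs_inf (K : numFieldType) (s : seq K) (q : K) : K :=
  \prod_(a <- s) qpoch_inf a q.

(* (a; q)_n *)
Definition qpoch (K : numFieldType) (a q : K) (n : nat) : K :=
  qpoch_inf a q / qpoch_inf (a * q ^+ n) q.

(* Unconditional summability of the family x, with sum l: the sums over finite
   sets of indices converge to l along the directed set of all such sets.
   Over R[i] this is absolute convergence. *)
Definition has_sum (K : numFieldType) (I : choiceType) (x : I -> K) (l : K) :=
  partial_sum x @ totally --> l.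

(* Index set of the multisum: s_1 >= ... >= s_k >= 0. *)
Definition chain (k : nat) := {s : k.-tuple nat | sorted geq s}.

(* s_i, with indices starting from 1 *)
Definition entry (k : nat) (s : chain k) (i : nat) : nat :=
  nth 0%N (val s) i.-1.

(* The summand in which the factors q^(-s_i) (1 + q^(s_(i-1) + s_i)), i in D,
   are present, the factor of index 1 being q^(-s_1) alone. All powers of q
   outside the parentheses are collected in a single integer exponent, which
   is nonnegative when D is a duplicate-free list of indices in 1..k, so that
   the case q = 0 is meaningful. *)
Definition multisum_term (K : numFieldType) (k r : nat) (q : K) (D : seq nat)
    (s : chain k) : K :=
  let s_ := entry s in
  q ^ ((\sum_(1 <= i < k.+1) s_ i ^ 2 + \sum_(k - r + 1 <= i < k.+1) s_ i
          + s_ k)%N%:Z - (\sum_(i <- D) s_ i)%N%:Z)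
  * \prod_(i <- D | (2 <= i)%N) (1 + q ^+ (s_ i.-1 + s_ i))
  / (\prod_(1 <= i < k) qpoch q q (s_ i - s_ i.+1)
       * qpoch (q ^+ 2) (q ^+ 2) (s_ k)).

(* For j + r <= k and s <= j none of the natural number subtractions in the
   exponents is truncated. *)
Definition product_side (K : numFieldType) (k r j : nat) (q : K) : K :=
  1 / (1 + q) *
  \sum_(0 <= s < j.+1) 'C(j, s)%:R *
    (qpochs_inf [:: q ^+ (2 * k + 2); q ^+ (k + 2 - r + j - 2 * s);
                    q ^+ (k + r - j + 2 * s)] (q ^+ (2 * k + 2))
       / qpoch_inf q q
     + q * (qpochs_inf [:: q ^+ (2 * k + 2); q ^+ (k - r + j - 2 * s);
                           q ^+ (k + 2 + r - j + 2 * s)] (q ^+ (2 * k + 2))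
              / qpoch_inf q q)).

(* Main.v *)
(** The multisum is evaluated from the innermost variable outwards with Bailey
    pairs relative to a = 1, i.e. sequences
      beta_n = sum_m alpha_m / ((q)_(n-m) (q)_(n+m)).
    By the q-Chu-Vandermonde formula, summing q^(s^2) beta_s / (q)_(n-s) over s
    multiplies alpha_m by q^(m^2), and a consequence of that formula is that
    summing q^(s^2-s) (1 + q^(n+s)) beta_s / (q)_(n-s) multiplies alpha_m by
    q^(m^2) (q^m + q^-m). These multipliers commute, which is why the position
    of the extra factors does not matter. The r innermost sums, of weight
    q^(s^2+s), act in the same way on Bailey pairs relative to a = q: the pair
      q^n / (q^2;q^2)_n = sum_m (-1)^m q^(m^2+m) / ((q)_(n-m) (q)_(n+m))
    is transported from a = 1 to a = q, and back after r steps, by a two-term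
    relation between the two kernels. When the outermost variable tends to infinity
    (Tannery), the multisum becomes a theta series in m; expanding
    (q^m + q^-m)^j by the binomial theorem and applying the Jacobi triple product
    gives the right-hand side. Sums over m in Z are folded onto m >= 0 so that
    all exponents are natural numbers and q = 0 needs no separate treatment. *)

Require Import Defs.
From mathcomp Require Import all_boot all_order all_algebra finmap.
From mathcomp Require Import all_classical all_reals all_analysis.
From mathcomp Require Import complex.
From mathcomp Require Import ring lra zify.
From mathcomp.analysis Require Import summability.
Import Order.TTheory GRing.Theory Num.Theory.
Import numFieldNormedType.Exports.
Set Implicit Arguments.
Unset Strict Implicit.
Unset Printing Implicit Defensive.
Local Open Scope classical_set_scope.
Local Open Scope ring_scope.

(** * Bailey pairs *)

Definition qfin (F : fieldType) (a q : F) (n : nat) : F :=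
  \prod_(0 <= m < n) (1 - a * q ^+ m).

(* 1 / (q; q)_(a - b), with the usual convention that it vanishes for a < b *)
Definition qinv (F : fieldType) (q : F) (a b : nat) : F :=
  if (b <= a)%N then (qfin q q (a - b))^-1 else 0.

Lemma qfin0 (F : fieldType) (a q : F) : qfin a q 0 = 1.
Proof. by rewrite /qfin big_geq. Qed.

Lemma qfinS (F : fieldType) (a q : F) n : qfin a q n.+1 = qfin a q n * (1 - a * q ^+ n).
Proof. by rewrite /qfin big_nat_recr. Qed.

Section FiniteIdentities.
Variables (F : fieldType) (q : F).
Hypothesis q_neq1 : forall n, 1 - q ^+ n.+1 != 0.

Lemma qqfinS n : qfin q q n.+1 = qfin q q n * (1 - q ^+ n.+1).
Proof. by rewrite qfinS exprS. Qed.

Lemma qqfin_neq0 n : qfin q q n != 0.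
Proof.
elim: n => [|n IH]; first by rewrite qfin0 oner_neq0.
by rewrite qqfinS mulf_neq0.
Qed.

Lemma qinvSS a b : qinv q a.+1 b.+1 = qinv q a b.
Proof. by []. Qed.

Lemma qinv_small a b : (a < b)%N -> qinv q a b = 0.
Proof. by rewrite /qinv ltnNge => /negbTE ->. Qed.

Lemma qinvnn a : qinv q a a = 1.
Proof. by rewrite /qinv leqnn subnn qfin0 invr1. Qed.

Lemma qinvDn a b : qinv q (a + b) b = (qfin q q a)^-1.
Proof. by rewrite /qinv leq_addl addnK. Qed.

Lemma qinvn0 a : qinv q a 0 = (qfin q q a)^-1.
Proof. by rewrite -[a in LHS]addn0 qinvDn. Qed.

Lemma qinv_decr a b : (b <= a)%N -> qinv q a b.+1 = (1 - q ^+ (a - b)) * qinv q a b.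
Proof.
move=> le_ba; rewrite -(subnK le_ba) addnK; case: (a - b)%N => [|d].
  by rewrite add0n qinv_small // subrr mul0r.
rewrite addSnnS qinvDn -addSnnS qinvDn qqfinS invfM mulrCA divff ?q_neq1 //.
by rewrite mulr1.
Qed.

Lemma qinv_incr a b : (b <= a.+1)%N -> qinv q a b = (1 - q ^+ (a.+1 - b)) * qinv q a.+1 b.
Proof. by move=> h; rewrite -qinv_decr. Qed.

Lemma qfactinvS n : (qfin q q n)^-1 = (1 - q ^+ n.+1) * (qfin q q n.+1)^-1.
Proof. by rewrite qqfinS invfM mulrCA divff ?q_neq1 // mulr1. Qed.

(** Induction on [n] for all [c], after multiplication by 1 - q^(n+1): writing this factor as (1 -
    q^(n+1-j)) + q^(n+1-j) (1 - q^j) splits the sum into the case (n, c) and, after a shift of [j],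
    the case (n, c+1). *)
Lemma qvandermonde n c :
  \sum_(0 <= j < n.+1) q ^+ (j * (j + c)) * qinv q n j / (qfin q q j * qfin q q (j + c))
  = (qfin q q n * qfin q q (n + c))^-1.
Proof.
elim: n c => [|n IH] c.
  by rewrite big_nat1 qinvnn mul0n mul1r mul1r.
have h1 := q_neq1 n.
apply: (mulfI h1).
have -> : (1 - q ^+ n.+1) / (qfin q q n.+1 * qfin q q (n.+1 + c)) =
  (qfin q q n * qfin q q (n + c))^-1 + q ^+ (n.+1 + c) * (qfin q q n * qfin q q (n + c.+1))^-1.
  by rewrite addnS addSn !invfM (qfactinvS n) (qfactinvS (n + c)); ring.
rewrite -(IH c) -(IH c.+1) !mulr_sumr.
rewrite (eq_big_nat _ _ (F2 := fun j =>
     q ^+ (j * (j + c)) * qinv q n j / (qfin q q j * qfin q q (j + c))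
   + q ^+ (n.+1 - j) * (1 - q ^+ j) * q ^+ (j * (j + c)) * qinv q n.+1 j
       / (qfin q q j * qfin q q (j + c)))); last first.
  move=> j /andP[_ hj]; have hj' : (j <= n.+1)%N by lia.
  have e : q ^+ n.+1 = q ^+ (n.+1 - j) * q ^+ j by rewrite -exprD subnK.
  rewrite (qinv_incr hj') e; ring.
rewrite big_split /=; congr (_ + _).
  by rewrite big_nat_recr //= qinv_small // mulr0 mul0r addr0.
rewrite big_nat_recl //= expr0 subrr mulr0 !mul0r add0r.
apply: eq_big_nat => j /andP[_ hj].
have e : q ^+ (n - j) * q ^+ (j.+1 * (j + c.+1)) = q ^+ (n.+1 + c) * q ^+ (j * (j + c.+1)).
  by rewrite -!exprD; congr (q ^+ _); nia.
rewrite qinvSS subSS addSnnS (mulrAC (q ^+ (n - j))) e !invfM (qfactinvS j).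
by ring.
Qed.

(** The summand splits through 1 + q^(n+j+c) = (1 + q^(n+c)) q^j + (1 - q^j). The first part is
    [qvandermonde] at (n, c), the second, after a shift of [j], at (n-1, c+1). *)
Lemma qvandermonde_shift n c :
  \sum_(0 <= j < n.+1) q ^+ (j * (j + c).-1) * (1 + q ^+ (n + j + c)) * qinv q n j
      / (qfin q q j * qfin q q (j + c))
  = (1 + q ^+ c) / (qfin q q n * qfin q q (n + c)).
Proof.
have -> : (1 + q ^+ c) / (qfin q q n * qfin q q (n + c)) =
   (1 + q ^+ (n + c)) / (qfin q q n * qfin q q (n + c))
    + (1 - q ^+ n) * q ^+ c / (qfin q q n * qfin q q (n + c)).
  rewrite exprD; ring.
rewrite -[X in _ * X + _]qvandermonde mulr_sumr.
rewrite (eq_big_nat _ _ (F2 := fun j =>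
     (1 + q ^+ (n + c))
       * (q ^+ (j * (j + c)) * qinv q n j / (qfin q q j * qfin q q (j + c)))
   + (1 - q ^+ j) * q ^+ (j * (j + c).-1) * qinv q n j
       / (qfin q q j * qfin q q (j + c)))); last first.
  move=> j /andP[_ hj].
  have -> : (j * (j + c) = j * (j + c).-1 + j)%N.
    case: j {hj} => [//|j]; rewrite addSn /= mulnS; lia.
  rewrite !exprD; ring.
rewrite big_split /=; congr (_ + _).
rewrite big_nat_recl //= expr0 subrr !mul0r add0r.
case: n => [|n]; first by rewrite big_geq // expr0 subrr !mul0r.
rewrite [RHS](_ : _ = q ^+ c * (qfin q q n * qfin q q (n + c.+1))^-1); last first.
  by rewrite !(addSn, addnS) !invfM (qfactinvS n); ring.
rewrite -(qvandermonde n c.+1) mulr_sumr; apply: eq_big_nat => j /andP[_ hj].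
have e : q ^+ (j.+1 * (j + c)) = q ^+ c * q ^+ (j * (j + c).+1).
  by rewrite -!exprD; congr (q ^+ _); nia.
by rewrite qinvSS !(addSn, addnS) /= e !invfM (qfactinvS j); ring.
Qed.

(* The matrices of Bailey pairs relative to a = 1 (kern0) and a = q (kern1), up
   to the factor 1 - q in the latter. *)
Definition kern0 n m : F := qinv q n m / qfin q q (n + m).
Definition kern1 n m : F := qinv q n m / qfin q q (n + m).+1.

Lemma kern0_small n m : (n < m)%N -> kern0 n m = 0.
Proof. by move=> h; rewrite /kern0 qinv_small // mul0r. Qed.

Lemma kern1_small n m : (n < m)%N -> kern1 n m = 0.
Proof. by move=> h; rewrite /kern1 qinv_small // mul0r. Qed.

Lemma sum_from m n (G : nat -> F) : (m <= n)%N -> (forall s, (s < m)%N -> G s = 0) ->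
  \sum_(0 <= s < n.+1) G s = \sum_(0 <= j < (n - m).+1) G (j + m)%N.
Proof.
move=> le_mn G0; rewrite (big_cat_nat _ (n := m)) //=; last by lia.
rewrite big_nat big1 ?add0r; last by move=> i /andP[_ /G0].
by rewrite -{1}[m]add0n big_addn subSn.
Qed.

(** With s = j + m this is [qvandermonde] at (n-m, 2m). In the same way [bailey1] uses (n-m, 2m+1),
    and [bailey0_shift] uses [qvandermonde_shift]. *)
Lemma bailey0 n m : (m <= n)%N ->
  \sum_(0 <= s < n.+1) q ^+ (s ^ 2) * qinv q n s * kern0 s m = q ^+ (m ^ 2) * kern0 n m.
Proof.
move=> le_mn; rewrite (sum_from le_mn); last first.
  by move=> s h; rewrite kern0_small // mulr0.
have e := qvandermonde (n - m) (m + m).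
rewrite addnA subnK // in e.
rewrite /kern0 [in RHS]/qinv le_mn -invfM -e mulr_sumr.
apply: eq_big_nat => j /andP[_ hj].
rewrite qinvDn -addnA (_ : qinv q n (j + m) = qinv q (n - m) j); last first.
  by rewrite /qinv -subnDA addnC -leq_subRL // addnC.
rewrite invfM (_ : ((j + m) ^ 2 = m ^ 2 + j * (j + (m + m)))%N); last by lia.
rewrite exprD; ring.
Qed.

Lemma bailey1 n m : (m <= n)%N ->
  \sum_(0 <= s < n.+1) q ^+ (s ^ 2 + s) * qinv q n s * kern1 s m = q ^+ (m ^ 2 + m) * kern1 n m.
Proof.
move=> le_mn; rewrite (sum_from le_mn); last first.
  by move=> s h; rewrite kern1_small // mulr0.
have e := qvandermonde (n - m) (m + m).+1.
rewrite !addnS addnA subnK // in e.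
rewrite /kern1 [in RHS]/qinv le_mn -invfM -e mulr_sumr.
apply: eq_big_nat => j /andP[_ hj].
rewrite qinvDn -addnA (_ : qinv q n (j + m) = qinv q (n - m) j); last first.
  by rewrite /qinv -subnDA addnC -leq_subRL // addnC.
rewrite invfM addnS (_ : ((j + m) ^ 2 + (j + m) = m ^ 2 + m + j * (j + (m + m)).+1)%N); last by lia.
rewrite exprD; ring.
Qed.

Lemma bailey0_shift n m : (m <= n)%N ->
  \sum_(0 <= s < n.+1) q ^+ (s ^ 2 - s) * (1 + q ^+ (n + s)) * qinv q n s * kern0 s m
  = q ^+ (m ^ 2 - m) * (1 + q ^+ (m + m)) * kern0 n m.
Proof.
move=> le_mn; rewrite (sum_from le_mn); last first.
  by move=> s h; rewrite kern0_small // mulr0.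
have e := qvandermonde_shift (n - m) (m + m).
rewrite addnA subnK // in e.
rewrite /kern0 [in RHS]/qinv le_mn -invfM -mulrA -e mulr_sumr.
apply: eq_big_nat => j /andP[_ hj].
rewrite qinvDn -addnA (_ : qinv q n (j + m) = qinv q (n - m) j); last first.
  by rewrite /qinv -subnDA addnC -leq_subRL // addnC.
rewrite invfM (_ : ((j + m) ^ 2 - (j + m) = m ^ 2 - m + j * (j + (m + m)).-1)%N); last first.
  by case: j {hj} => [|j]; rewrite ?addn0 ?add0n // addSn /=; nia.
rewrite (_ : (n - m + j + (m + m) = n + (j + m))%N); last by lia.
rewrite exprD; ring.
Qed.


Lemma kern0E n m : kern0 n m = (1 - q ^+ (n + m).+1) * kern1 n m.
Proof. by rewrite /kern0 /kern1 qfactinvS; ring. Qed.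

Lemma kern0S n m : (m <= n)%N -> kern0 n m.+1 = (1 - q ^+ (n - m)) * kern1 n m.
Proof. by move=> le_mn; rewrite /kern0 /kern1 qinv_decr // addnS; ring. Qed.

(** [kern0] at m and m+1 is [kern1 n m] times 1 - q^(n+m+1) and 1 - q^(n-m) respectively, and the
    terms in q^(n+m+1) cancel. *)
Lemma kern1_diff n m : (m <= n)%N ->
  (1 - q ^+ m.*2.+1) * kern1 n m = kern0 n m - q ^+ m.*2.+1 * kern0 n m.+1.
Proof.
move=> le_mn; rewrite kern0S // kern0E.
have -> : q ^+ (n + m).+1 = q ^+ m.*2.+1 * q ^+ (n - m).
  by rewrite -exprD; congr (q ^+ _); lia.
by ring.
Qed.

(** Summation by parts against [kern1_diff]; the boundary term vanishes because [kern0 n n.+1] is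
    0. *)
Lemma kern0_to_kern1 (a g : nat -> F) n :
  a 0 = g 0 -> (forall m, a m.+1 = g m.+1 - q ^+ m.*2.+1 * g m) ->
  \sum_(0 <= m < n.+1) a m * kern0 n m
  = \sum_(0 <= m < n.+1) g m * (1 - q ^+ m.*2.+1) * kern1 n m.
Proof.
move=> a0 aS.
have -> : \sum_(0 <= m < n.+1) g m * (1 - q ^+ m.*2.+1) * kern1 n m =
   \sum_(0 <= m < n.+1) g m * kern0 n m
   - \sum_(0 <= m < n.+1) q ^+ m.*2.+1 * g m * kern0 n m.+1.
  rewrite -sumrB; apply: eq_big_nat => m /andP[_ le_mn].
  by rewrite -mulrA kern1_diff //; ring.
rewrite big_nat_recl // [X in _ = X - _]big_nat_recl //.
rewrite [X in _ = _ - X]big_nat_recr //= (kern0_small (ltnSn n)) mulr0 addr0 a0 -addrA.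
congr (_ + _); rewrite -sumrB; apply: eq_big_nat => m _.
by rewrite aS; ring.
Qed.

(** * A finite form of the Jacobi triple product *)

Lemma kern0_incr n m : (m <= n.+1)%N ->
  kern0 n m = (1 - q ^+ (n.+1 - m)) * (1 - q ^+ (n.+1 + m)) * kern0 n.+1 m.
Proof. by move=> h; rewrite /kern0 qinv_incr // qfactinvS addSn; ring. Qed.

(* The terms of index m and -m, taken together, of the theta series
   sum_m (-1)^m q^(m(m-1)/2) x^m = (q, x, q/x; q)_oo, where y = q/x. *)
Definition jacobi_coef x y m : F :=
  if m is 0 then 1 else (-1) ^+ m * q ^+ 'C(m, 2) * (x ^+ m + y ^+ m).

(* This telescoping certificate yields the recurrence in n of the sum in jacobi_finite. *)
Lemma jacobi_prefix x y n M : x * y = q -> (M <= n.+1)%N ->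
  \sum_(0 <= m < M.+1) jacobi_coef x y m *
     ((1 - q ^+ n.*2.+1) * (1 - q ^+ n.+1.*2) * kern0 n.+1 m
      - (1 - (x + y) * q ^+ n + q ^+ n.*2.+1) * kern0 n m)
  = (-1) ^+ M * q ^+ n * q ^+ 'C(M, 2) *
     (kern0 n M * (x ^+ M.+1 + y ^+ M.+1) + q ^+ M * (q * kern0 n M.+1) * (x ^+ M + y ^+ M)).
Proof.
move=> xy; elim: M => [_|M IH le_Mn].
  have e0 : kern0 n 0 = (1 - q ^+ n.+1) ^+ 2 * kern0 n.+1 0.
    by rewrite (kern0_incr (leq0n n.+1)) subn0 addn0; ring.
  have e1 : kern0 n 1 = (1 - q ^+ n) * (1 - q ^+ n.+1) * kern0 n.+1 0.
    by rewrite kern0S // subn0 /kern1 /kern0 !addn0 !qinvn0 (qfactinvS n); ring.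
  have e2 : q ^+ n.*2.+1 = q * (q ^+ n) ^+ 2 by rewrite -exprM exprS muln2.
  have e3 : q ^+ n.+1.*2 = q ^+ 2 * (q ^+ n) ^+ 2.
    by rewrite -exprM -exprD; congr (q ^+ _); lia.
  rewrite big_nat1 /jacobi_coef e0 e1 e2 e3 (exprS q n) bin_small // !expr0 !expr1.
  by move: (kern0 _ _) (q ^+ n) => K u; ring.
rewrite big_nat_recr //= IH; last exact: ltnW.
have [K0 | lt_Mn'] := ltnP n M; first by lia.
have -> : kern0 n M = (1 - q ^+ (n + M).+1) * (1 - q ^+ (n + M).+2) * kern0 n.+1 M.+1.
  by rewrite /kern0 qinvSS addSn addnS (qfactinvS (n + M)) (qfactinvS (n + M).+1); ring.
(* The factor [q] attached to the kernel turns 1 - q^(n-M-1) into q - q^(n-M), which still makes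
   sense at M = n, where the natural subtraction would truncate. *)
have -> : q * kern0 n M.+2 = (q - q ^+ (n - M)) * (1 - q ^+ (n - M)) * kern0 n.+1 M.+1.
  have [-> | lt_Mn] := eqVneq M n.
    by rewrite kern0_small // subnn expr0 subrr !mulr0 mul0r.
  have lt_Mn1 : (M < n)%N by rewrite ltn_neqAle lt_Mn.
  have e : q ^+ (n - M) = q * q ^+ (n - M.+1) by rewrite -exprS; congr (q ^+ _); lia.
  by rewrite /kern0 qinvSS addSn !addnS !qinv_decr // e; ring.
have -> : kern0 n M.+1 = (1 - q ^+ (n - M)) * (1 - q ^+ (n + M).+2) * kern0 n.+1 M.+1.
  by rewrite /kern0 qinvSS addSn !addnS qinv_decr // (qfactinvS (n + M).+1); ring.
(* In terms of d = n - M every power of [q] is a monomial in [q], q^d and q^M, and a polynomial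
   identity modulo xy = q remains. *)
have [d n_eq] : exists d, n = (d + M)%N by exists (n - M)%N; lia.
have -> : q ^+ (n - M) = q ^+ d by congr (q ^+ _); lia.
have -> : q ^+ n.+1.*2 = (q * q ^+ d * q ^+ M) ^+ 2.
  by rewrite -exprS -exprD -exprM; congr (q ^+ _); lia.
have -> : q ^+ n.*2.+1 = q * (q ^+ d * q ^+ M) ^+ 2.
  by rewrite -exprD -exprM -exprS; congr (q ^+ _); lia.
have -> : q ^+ (n + M).+2 = q ^+ 2 * q ^+ d * (q ^+ M) ^+ 2.
  by rewrite -exprM -!exprD; congr (q ^+ _); lia.
have -> : q ^+ (n + M).+1 = q * q ^+ d * (q ^+ M) ^+ 2.
  by rewrite -exprM -exprS -!exprD; congr (q ^+ _); lia.
have -> : q ^+ n = q ^+ d * q ^+ M by rewrite -exprD; congr (q ^+ _); lia.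
rewrite /jacobi_coef binS bin1 exprD [(-1) ^+ M.+1]exprS [q ^+ M.+1]exprS.
rewrite [x ^+ M.+2]exprS [y ^+ M.+2]exprS [x ^+ M.+1]exprS [y ^+ M.+1]exprS.
move: (kern0 n.+1 M.+1) (q ^+ 'C(M, 2)) (q ^+ d) (q ^+ M) ((-1) ^+ M) (x ^+ M) (y ^+ M).
by move=> K c u v s a b; rewrite -xy; ring.
Qed.

(** At M = n+1 the right-hand side of [jacobi_prefix] is 0, as both kernels vanish there. This
    leaves a first-order recurrence in [n], whose coefficient factors as (1 - x q^n) (1 - y q^n)
    because xy = q. *)
Lemma jacobi_finite x y n : x * y = q ->
  \sum_(0 <= m < n.+1) jacobi_coef x y m * kern0 n m
  = qfin x q n * qfin y q n / qfin q q n.*2.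
Proof.
move=> xy; elim: n => [|n IH].
  by rewrite big_nat1 /kern0 /jacobi_coef qinvnn addn0 !qfin0 !mul1r.
have h : (1 - q ^+ n.*2.+1) * (1 - q ^+ n.+1.*2) != 0 by rewrite mulf_neq0 // q_neq1.
apply: (mulfI h).
transitivity ((1 - (x + y) * q ^+ n + q ^+ n.*2.+1) * (qfin x q n * qfin y q n / qfin q q n.*2)).
  rewrite -IH.
  have -> : \sum_(0 <= m < n.+1) jacobi_coef x y m * kern0 n m
    = \sum_(0 <= m < n.+2) jacobi_coef x y m * kern0 n m.
    by rewrite [RHS]big_nat_recr //= (kern0_small (ltnSn n)) mulr0 addr0.
  apply/eqP; rewrite -subr_eq0 !mulr_sumr -sumrB.
  have := jacobi_prefix xy (leqnn n.+1).
  rewrite !kern0_small // mulr0 mulr0 !mul0r addr0 mulr0 => e; apply/eqP.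
  by rewrite -[RHS]e; apply: eq_big_nat => m _; ring.
rewrite (qfinS x) (qfinS y) doubleS !qqfinS.
have -> : 1 - (x + y) * q ^+ n + q ^+ n.*2.+1 = (1 - x * q ^+ n) * (1 - y * q ^+ n).
  by rewrite exprS -addnn exprD -[in X in _ + X * _]xy; ring.
have h1 := q_neq1 n.*2; have h2 := q_neq1 n.*2.+1.
by field; rewrite h1 h2 qqfin_neq0.
Qed.

(** * The innermost Bailey pair and its transport between a = 1 and a = q *)

Hypothesis q1_neq0 : 1 + q != 0.

(* The alpha-sequence, folded onto m >= 0, of the Bailey pair relative to a = 1
   whose beta-sequence is the sum over the r innermost variables; unfolded, it is
   (-1)^m q^((r+1)m^2 + rm) (q^-m + q^(m+1)) / (1 + q). *)
Definition alpha r m : F :=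
  if m is 0 then 1 else
  (-1) ^+ m * q ^+ (r.+1 * (m ^ 2 - m))
  * (q ^+ (r * m.*2) * (1 + q ^+ m.*2.+1) + q + q ^+ m.*2) / (1 + q).

(* alpha_half r m * (1 - q^(2m+1)) is the alpha-sequence of the same pair relative
   to a = q, folded along m |-> - m - 1. *)
Definition alpha_half r m : F :=
  (-1) ^+ m * q ^+ (r * (m ^ 2 + m) + (m ^ 2 - m)) * (1 + q ^+ m.*2.+1) / (1 + q).

Lemma alpha0E m : alpha 0 m.+1 = (-1) ^+ m.+1 * q ^+ (m.+1 ^ 2 - m.+1) * (1 + q ^+ m.+1.*2).
Proof.
rewrite /alpha mul1n mul0n expr0 mul1r (exprS q m.+1.*2); move: (q ^+ m.+1.*2) => x.
by rewrite (_ : 1 + q * x + q + x = (1 + q) * (1 + x)) ?mulrA; [field|ring].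
Qed.

Lemma alpha_half0 r : alpha_half r 0 = 1.
Proof. by rewrite /alpha_half addn0 muln0 !expr0 expr1 !mul1r divff. Qed.

Lemma alpha_halfS r m : alpha r m.+1 = alpha_half r m.+1 - q ^+ m.*2.+1 * alpha_half r m.
Proof.
rewrite /alpha /alpha_half.
have e1 : q ^+ (r * (m.+1 ^ 2 + m.+1) + (m.+1 ^ 2 - m.+1)) =
  q ^+ (r.+1 * (m.+1 ^ 2 - m.+1)) * q ^+ (r * m.+1.*2).
  by rewrite -exprD; congr (q ^+ _); nia.
have e2 : q * q ^+ (r.+1 * (m.+1 ^ 2 - m.+1)) =
  q ^+ m.*2.+1 * q ^+ (r * (m ^ 2 + m) + (m ^ 2 - m)).
  by rewrite -exprD -exprS; congr (q ^+ _); nia.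
have e3 : q ^+ m.+1.*2 = q * q ^+ m.*2.+1.
  by rewrite doubleS exprS.
rewrite e1 [(-1) ^+ m.+1]exprS.
have -> : q ^+ m.*2.+1 * ((-1) ^+ m * q ^+ (r * (m ^ 2 + m) + (m ^ 2 - m))
              * (1 + q ^+ m.*2.+1) / (1 + q))
  = (-1) ^+ m * (q * q ^+ (r.+1 * (m.+1 ^ 2 - m.+1))) * (1 + q ^+ m.*2.+1) / (1 + q).
  by rewrite e2; ring.
rewrite (_ : q ^+ m.+1.*2.+1 = q * q * q ^+ m.*2.+1) ?e3; last first.
  by rewrite doubleS !exprS; ring.
by field.
Qed.

(** Serves in both directions: at r = 0 it carries the innermost pair to a = q, and for general [r]
    it brings the result back to a = 1. *)
Lemma alpha_kern01 r n :
  \sum_(0 <= m < n.+1) alpha r m * kern0 n m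
  = \sum_(0 <= m < n.+1) alpha_half r m * (1 - q ^+ m.*2.+1) * kern1 n m.
Proof.
apply: kern0_to_kern1; first by rewrite alpha_half0.
by move=> m; exact: alpha_halfS.
Qed.

(* The telescoping certificate of the recurrence (1 - q^(2n)) f_n = q f_(n-1) for
   the sum f_n in alpha0_kern0. *)
Lemma alpha0_prefix n M : (M <= n)%N ->
  \sum_(0 <= m < M.+1) alpha 0 m * kern0 n m *
     (1 - q ^+ n.*2 - q * ((1 - q ^+ (n - m)) * (1 - q ^+ (n + m))))
  = (-1) ^+ M * ((1 - q ^+ (n - M)) * kern0 n M) *
     (q ^+ n * (q ^+ (M.+1 ^ 2) + q ^+ (M ^ 2)) + (1 - q) * q ^+ (M ^ 2 + M)).
Proof.
elim: M => [_|M IH lt_Mn].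
  by rewrite big_nat1 /alpha subn0 !addn0 !expr0 exp1n !expr1 -addnn exprD; ring.
rewrite big_nat_recr //= IH; last exact: ltnW.
have -> : (1 - q ^+ (n - M)) * kern0 n M = (1 - q ^+ (n + M.+1)) * kern0 n M.+1.
  by rewrite kern0S ?(ltnW lt_Mn) // kern0E addnS; ring.
rewrite -/(alpha 0 M.+1) alpha0E.
have [d n_eq] : exists d, n = (d + M.+1)%N by exists (n - M.+1)%N; lia.
have -> : q ^+ (n - M.+1) = q ^+ d by congr (q ^+ _); lia.
have -> : q ^+ (n + M.+1) = q ^+ d * (q ^+ M) ^+ 2 * q ^+ 2.
  by rewrite -exprM -!exprD; congr (q ^+ _); lia.
have -> : q ^+ n.*2 = (q ^+ d * q ^+ M * q) ^+ 2.
  by rewrite -exprD -exprSr -exprM; congr (q ^+ _); lia.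
have -> : q ^+ n = q ^+ d * q ^+ M * q by rewrite -exprD -exprSr; congr (q ^+ _); lia.
have -> : q ^+ (M.+2 ^ 2) = q ^+ (M ^ 2) * (q ^+ M) ^+ 4 * q ^+ 4.
  by rewrite -exprM -!exprD; congr (q ^+ _); lia.
have -> : q ^+ (M.+1 ^ 2 + M.+1) = q ^+ (M ^ 2) * (q ^+ M) ^+ 3 * q ^+ 2.
  by rewrite -exprM -!exprD; congr (q ^+ _); lia.
have -> : q ^+ (M.+1 ^ 2 - M.+1) = q ^+ (M ^ 2) * q ^+ M.
  by rewrite -exprD; congr (q ^+ _); lia.
have -> : q ^+ (M.+1 ^ 2) = q ^+ (M ^ 2) * (q ^+ M) ^+ 2 * q.
  by rewrite -exprM -exprD -exprSr; congr (q ^+ _); lia.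
have -> : q ^+ (M ^ 2 + M) = q ^+ (M ^ 2) * q ^+ M by rewrite exprD.
have -> : q ^+ M.+1.*2 = (q ^+ M) ^+ 2 * q ^+ 2.
  by rewrite -exprM -exprD; congr (q ^+ _); lia.
rewrite [(-1) ^+ M.+1]exprS; move: (kern0 n M.+1) (q ^+ d) (q ^+ M) (q ^+ (M ^ 2)) ((-1) ^+ M).
by move=> k u x y z; ring.
Qed.

Lemma sqr_q_neq1 n : 1 - q ^+ 2 ^+ n.+1 != 0.
Proof. by rewrite -exprM mul2n doubleS q_neq1. Qed.

Lemma alpha0_kern0 n :
  \sum_(0 <= m < n.+1) alpha 0 m * kern0 n m = q ^+ n / qfin (q ^+ 2) (q ^+ 2) n.
Proof.
elim: n => [|n IH].
  by rewrite big_nat1 /alpha /kern0 qinvnn addn0 !qfin0 expr0 !mul1r.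
have h := sqr_q_neq1 n.
apply: (mulfI h).
transitivity (q * (q ^+ n / qfin (q ^+ 2) (q ^+ 2) n)); last first.
  rewrite qfinS -(exprS (q ^+ 2) n) (exprS q n) invfM; move: ((qfin _ _ n)^-1) (q ^+ n) => b a.
  by rewrite -[LHS]mul1r -[X in X * _ = _](divff h); ring.
rewrite -IH.
(* At M = n+1 the certificate contains the factor 1 - q^0 = 0, so what remains is the recurrence
   itself. *)
have e := alpha0_prefix (leqnn n.+1).
rewrite subnn expr0 subrr mul0r mulr0 mul0r in e.
apply/eqP; rewrite -subr_eq0; apply/eqP; rewrite -[RHS]e {e}.
have -> : \sum_(0 <= m < n.+1) alpha 0 m * kern0 n m = \sum_(0 <= m < n.+2) alpha 0 m * kern0 n m.
  by rewrite [RHS]big_nat_recr //= (kern0_small (ltnSn n)) mulr0 addr0.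
rewrite !mulr_sumr -sumrB; apply: eq_big_nat => m /andP[_ hm].
by rewrite [kern0 n m]kern0_incr // -exprM mul2n; ring.
Qed.

End FiniteIdentities.

(** Here [i] is the index of the outermost variable still to be summed, and [n] is the value of the
    preceding variable, which bounds it and also enters its weight. *)
Fixpoint iter_sum (F : fieldType) (w : nat -> nat -> nat -> F) (b : nat -> F) k i n : F :=
  if k is k'.+1 then \sum_(0 <= s < n.+1) w i n s * iter_sum w b k' i.+1 s else b n.

Lemma perm_filter_iota (D : seq nat) n : uniq D -> (forall i, i \in D -> (1 <= i <= n)%N) ->
  perm_eq D [seq i <- index_iota 1 n.+1 | i \in D].
Proof.
move=> uD hD; apply: uniq_perm => //; first by rewrite filter_uniq // iota_uniq.
move=> i; rewrite mem_filter mem_index_iota.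
by case: (boolP (i \in D)) => //= iD; rewrite ltnS (hD _ iD).
Qed.

Lemma size_sub_iota (D : seq nat) n : uniq D -> (forall i, i \in D -> (1 <= i <= n)%N) ->
  (size D <= n)%N.
Proof.
move=> uD hD; rewrite (perm_size (perm_filter_iota uD hD)) size_filter.
by rewrite (leq_trans (count_size _ _)) // size_iota subSS subn0.
Qed.

(** * Evaluation of the iterated sum by successive Bailey steps *)

Section IteratedSums.
Variables (F : fieldType) (q : F).
(* D is the set of indices carrying the extra factor; the indices above t = k - r
   carry the extra power q^(s_i). *)
Variables (D : seq nat) (t : nat).

(** The part of the weight that is independent of the preceding variable and so survives when that
    variable tends to infinity. The subtraction does not truncate, since s <= s^2. *)
Definition top_weight i s : F := q ^+ (s ^ 2 - (i \in D) * s + (t < i) * s).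

Definition shift_factor i n s : F := if i \in D then 1 + q ^+ (n + s) else 1.

Definition weight i n s : F := top_weight i s * shift_factor i n s * qinv q n s.

Definition base n : F := q ^+ n / qfin (q ^+ 2) (q ^+ 2) n.

(** For [i] in [D] this is q^(m^2) (q^m + q^-m), written without negative powers. *)
Definition bailey_mult i m : F :=
  if i \in D then q ^+ (m ^ 2 - m) * (1 + q ^+ (m + m)) else q ^+ (m ^ 2).

(* The two sums over the triangle [m <= s <= n] are exchanged after extension to
   a square, where the terms with [s < m] vanish. *)
Lemma exchange_kern (u : nat -> F) (a : nat -> F) (kern : nat -> nat -> F) n :
  (forall s m, (s < m)%N -> kern s m = 0) ->
  \sum_(0 <= s < n.+1) u s * (\sum_(0 <= m < s.+1) a m * kern s m)
  = \sum_(0 <= m < n.+1) a m * \sum_(0 <= s < n.+1) u s * kern s m.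
Proof.
move=> kern0.
under eq_big_nat => s /andP[_ hs].
  rewrite (_ : \sum_(0 <= m < s.+1) a m * kern s m
             = \sum_(0 <= m < n.+1) a m * kern s m); last first.
    rewrite [RHS](big_cat_nat _ (n := s.+1)) //=.
    rewrite [X in _ = _ + X]big_nat [X in _ = _ + X]big1 ?addr0 // => m /andP[h _].
    by rewrite kern0 // mulr0.
  rewrite mulr_sumr; over.
rewrite exchange_big_nat /=; apply: eq_bigr => m _; rewrite mulr_sumr.
by apply: eq_bigr => s _; ring.
Qed.

Hypothesis D_le : forall i, i \in D -> (i <= t)%N.

(** Only the cardinality of [D] enters the result; this is what makes the choice of the j factors
    immaterial. *)
Lemma prod_bailey_mult m : uniq D -> (forall i, i \in D -> (0 < i)%N) ->
  \prod_(1 <= i < t.+1) bailey_mult i m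
  = q ^+ (t * m ^ 2 - size D * m) * (1 + q ^+ m.*2) ^+ size D.
Proof.
move=> uD D_gt0.
have pD := perm_filter_iota uD (fun i iD => introT andP (conj (D_gt0 i iD) (D_le iD))).
have e : (size D * (m ^ 2 - m) + (t - size D) * m ^ 2 = t * m ^ 2 - size D * m)%N.
  have : (size D <= t)%N.
    by rewrite (perm_size pD) size_filter (leq_trans (count_size _ _)) // size_iota subSS subn0.
  by move: (size D) => d le_dt; rewrite -[t in RHS](subnK le_dt); case: m => [|m]; nia.
rewrite -e {e} (bigID (mem D)) /=.
rewrite (eq_bigr (fun=> q ^+ (m ^ 2 - m) * (1 + q ^+ m.*2))); last first.
  by move=> i iD; rewrite /bailey_mult iD addnn.
rewrite [X in _ * X](eq_bigr (fun=> q ^+ (m ^ 2))); last first.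
  by move=> i /negbTE iD; rewrite /bailey_mult iD.
rewrite !big_const_seq !iter_mulr_1.
have c1 : count (fun i => i \in D) (index_iota 1 t.+1) = size D.
  by rewrite [RHS](perm_size pD) size_filter.
have -> : count (fun i => i \notin D) (index_iota 1 t.+1) = (t - size D)%N.
  have := count_predC (fun i => i \in D) (index_iota 1 t.+1).
  by rewrite c1 size_iota subSS subn0 => e'; rewrite -[in RHS]e' addKn.
rewrite (_ : count _ _ = size D) // exprMn exprD -!exprM.
by rewrite ![(_ * size D)%N]mulnC ![(_ * (t - size D))%N]mulnC; ring.
Qed.

Hypothesis q_neq1 : forall n, 1 - q ^+ n.+1 != 0.
Hypothesis q1_neq0 : 1 + q != 0.

(** No index above [t] lies in [D], so each sum is an instance of [bailey1] and adds m^2 + m to the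
    exponent in [alpha_half]. *)
Lemma iter_sum_low l i n : (t < i)%N ->
  iter_sum weight base l i n
  = \sum_(0 <= m < n.+1) alpha_half q l m * (1 - q ^+ m.*2.+1) * kern1 q n m.
Proof.
elim: l i n => [|l IH] i n lt_ti /=.
  by rewrite -alpha_kern01 // alpha0_kern0.
have iND : (i \in D) = false by apply/negbTE/negP => /D_le; rewrite leqNgt lt_ti.
under eq_big_nat => s _ do rewrite IH ?(ltn_trans lt_ti) //.
rewrite exchange_kern; last by move=> *; rewrite kern1_small.
apply: eq_big_nat => m /andP[_ le_mn].
under eq_bigr => s _ do
  rewrite /weight /top_weight /shift_factor iND lt_ti mul0n subn0 mul1n mulr1.
rewrite bailey1 // /alpha_half.
rewrite (_ : l.+1 * (m ^ 2 + m) + _ = (m ^ 2 + m) + (l * (m ^ 2 + m) + (m ^ 2 - m)))%N.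
  by rewrite [q ^+ (_ + (_ + _))]exprD; ring.
by rewrite mulSn addnA.
Qed.

(** Induction on the number [h] of sums with index at most [t], from the inside outwards. For h = 0
    the pair returns to a = 1; each further sum contributes one [bailey_mult]. *)
Lemma iter_sum_high l h n : (h <= t)%N ->
  iter_sum weight base (h + l) (t.+1 - h) n
  = \sum_(0 <= m < n.+1)
       (alpha q l m * \prod_(t.+1 - h <= i < t.+1) bailey_mult i m) * kern0 q n m.
Proof.
elim: h n => [|h IH] n le_ht.
  rewrite add0n subn0 iter_sum_low // -alpha_kern01 //.
  by apply: eq_bigr => m _; rewrite big_geq // mulr1.
have lt_ti : (t < t.+1 - h.+1)%N = false by apply/negbTE; rewrite -leqNgt subSS leq_subr.
have iS : (t.+1 - h.+1).+1 = (t.+1 - h)%N by lia.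
have lt_i : (t.+1 - h.+1 < t.+1)%N by rewrite ltn_subrL.
move: (t.+1 - h.+1)%N lt_ti iS lt_i => i lt_ti iS lt_i.
rewrite addSn /= iS.
under eq_bigr => s _ do rewrite IH ?(ltnW le_ht) //.
rewrite exchange_kern; last by move=> *; rewrite kern0_small.
apply: eq_big_nat => m /andP[_ le_mn].
rewrite (big_ltn lt_i) iS [bailey_mult i m]/bailey_mult.
move: (\prod_(_ <= _ < _) _) => P.
case: ifP => iD.
  under eq_bigr => s _ do
    rewrite /weight /top_weight /shift_factor iD lt_ti mul0n addn0 mul1n.
  by rewrite bailey0_shift //; ring.
under eq_bigr => s _ do
  rewrite /weight /top_weight /shift_factor iD lt_ti !mul0n addn0 subn0 mulr1.
by rewrite bailey0 //; ring.
Qed.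

Lemma iter_sum_kern0 l n :
  iter_sum weight base (t + l) 1 n
  = \sum_(0 <= m < n.+1)
       (alpha q l m * \prod_(1 <= i < t.+1) bailey_mult i m) * kern0 q n m.
Proof. by have := iter_sum_high l n (leqnn t); rewrite subSnn. Qed.

End IteratedSums.

Lemma cvg_sum_nat (K : numFieldType) (u : nat -> nat -> K) (l : nat -> K) m :
  (forall s, (s < m)%N -> u ^~ s @ \oo --> l s) ->
  (fun n => \sum_(0 <= s < m) u n s) @ \oo --> \sum_(0 <= s < m) l s.
Proof.
elim: m => [|m IH] ul.
  by rewrite big_geq //; under eq_fun do rewrite big_geq //; exact: cvg_cst.
rewrite big_nat_recr //=; under eq_fun do rewrite big_nat_recr //=.
by apply: cvgD; [apply: IH => s lt_sm; apply: ul; exact: ltnW | exact: ul].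
Qed.

(** * Limits *)

Section Tannery.
Variables (K : numFieldType) (rho : K).
Hypotheses (rho_ge0 : 0 <= rho) (rho_lt1 : rho < 1).
Hypothesis rho_cvg0 : (fun n => rho ^+ n) @ \oo --> 0.

Lemma geometric_tail M n :
  \sum_(M.+1 <= s < n) rho ^+ s.-1 <= rho ^+ M / (1 - rho).
Proof.
have h : 0 < 1 - rho by rewrite subr_gt0.
have [le_nM | lt_Mn] := leqP n M.+1.
  by rewrite big_geq // divr_ge0 ?exprn_ge0 // ltW.
have -> : \sum_(M.+1 <= s < n) rho ^+ s.-1 = (rho ^+ M - rho ^+ n.-1) / (1 - rho).
  rewrite -(subnKC lt_Mn) addSn; elim: (n - M.+2)%N => [|d IH].
    rewrite addn0 big_nat1 /= exprSr; field; exact: lt0r_neq0.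
  rewrite addnS big_nat_recr /= ?IH //; last by lia.
  by rewrite exprS; field; exact: lt0r_neq0.
by rewrite ler_pM2r ?invr_gt0 // gerBl exprn_ge0.
Qed.

Lemma geometric_sum n : \sum_(0 <= s < n) rho ^+ s.-1 <= 1 + (1 - rho)^-1.
Proof.
have h : 0 <= (1 - rho)^-1 by rewrite invr_ge0 subr_ge0 ltW.
case: n => [|n]; first by rewrite big_geq // addr_ge0.
rewrite big_ltn // lerD //=; have := geometric_tail 0 n.+1.
by rewrite expr0 div1r.
Qed.

(** After a cut at [M], the tail is small uniformly in [n] and the finitely many other terms tend to
    0. The exponent [s.-1] suits weights such as q^(s^2-s), which equals 1 at both s = 0 and s =
    1. *)
Lemma tannery (h : nat -> nat -> K) (B : K) :
  (forall n s, `|h n s| <= B * rho ^+ s.-1) ->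
  (forall s, h ^~ s @ \oo --> 0) ->
  (fun n => \sum_(0 <= s < n.+1) h n s) @ \oo --> 0.
Proof.
move=> hB h0.
have h1 : 0 < 1 - rho by rewrite subr_gt0.
have B_ge0 : 0 <= B by have := hB 0 0; rewrite expr0 mulr1; apply: le_trans.
apply/cvgrPdist_lt => e e_gt0.
have e2_gt0 : 0 < e / 2 by rewrite divr_gt0.
have : (fun n => B * (rho ^+ n / (1 - rho))) @ \oo --> B * (0 / (1 - rho)).
  by apply: cvgMr; apply: cvgMl.
rewrite mul0r mulr0 => /cvgrPdist_lt /(_ _ e2_gt0) [M _ hM].
have {hM} := hM M (leqnn M); rewrite /= sub0r normrN => hM.
have hM' : B * (rho ^+ M / (1 - rho)) < e / 2.
  by move: hM; rewrite ger0_norm // mulr_ge0 // divr_ge0 ?exprn_ge0 // ltW.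
have : (fun n => \sum_(0 <= s < M.+1) h n s) @ \oo --> \sum_(0 <= s < M.+1) (0 : K).
  exact: (cvg_sum_nat (l := fun=> 0)).
rewrite big1 // => /cvgrPdist_lt /(_ _ e2_gt0) hfin.
near=> n.
have le_Mn : (M <= n)%N by near: n; exists M.
rewrite sub0r normrN (big_cat_nat _ (n := M.+1)) //=.
rewrite (le_lt_trans (ler_normD _ _)) // [e]splitr ltrD //.
  have : `|0 - \sum_(0 <= s < M.+1) h n s| < e / 2 by near: n; exact: hfin.
  by rewrite sub0r normrN.
rewrite (le_lt_trans _ hM') // (le_trans (ler_norm_sum _ _ _)) //.
rewrite (le_trans (ler_sum _ (fun s _ => hB n s))) // -mulr_sumr.
by rewrite ler_wpM2l // geometric_tail.
Unshelve. all: by end_near.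
Qed.

End Tannery.

(** * Convergence of complex sequences *)

Section ComplexLimits.
Variable R : realType.
Let C : numFieldType := R[i].

Lemma cvg_real_complex (u : nat -> R) (a : R) :
  u @ \oo --> a -> (fun n => (u n)%:C%C : C) @ \oo --> (a%:C%C : C).
Proof.
move=> /cvgrPdist_lt ua; apply/cvgrPdist_lt => e e_gt0.
(* In the partial order of the complex numbers a positive element is real, so [e] can serve as a
   real tolerance. *)
have /complex_realP [r er] : (e : R[i]) \is Num.real by rewrite gtr0_real.
have r_gt0 : 0 < r by move: e_gt0; rewrite er ltcR.
have := ua r r_gt0; apply: filterS => n /=.
by rewrite er -rmorphB /= normc_def /= expr0n addr0 sqrtr_sqr ltcR.
Qed.

Lemma norm_complexP (x : C) : exists2 r : R, 0 <= r & `|x| = r%:C%C.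
Proof.
have /complex_realP [r er] : (`|x| : R[i]) \is Num.real by rewrite normr_real.
by exists r => //; rewrite -ler0c -er normr_ge0.
Qed.

Lemma cvg_expC (x : C) : `|x| < 1 -> (fun n => x ^+ n) @ \oo --> (0 : C).
Proof.
have [r r_ge0 er] := norm_complexP x; rewrite er ltcR => r_lt1.
have : (fun n => (r ^+ n)%:C%C : C) @ \oo --> ((0 : R)%:C%C : C).
  by apply: cvg_real_complex; apply: cvg_expr; rewrite ger0_norm.
move=> /cvgrPdist_lt h; apply/cvgrPdist_lt => e /h; apply: filterS => n.
by rewrite !sub0r !normrN rmorphXn /= -er !normrX normr_id.
Qed.

Lemma cvg_complexE (u : nat -> C) : cvgn (fun n => complex.Re (u n)) ->
  cvgn (fun n => complex.Im (u n)) -> cvgn u.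
Proof.
move=> /cvg_ex [a ha] /cvg_ex [b hb].
apply/cvg_ex; exists ((a%:C + 'i * b%:C)%C : C).
rewrite (_ : u = fun n => ((complex.Re (u n))%:C + 'i * (complex.Im (u n))%:C)%C : C); last first.
  by apply/funext => n; rewrite -complexE.
apply: (@cvgD _ C); first exact: cvg_real_complex.
by apply: (@cvgMr C); exact: cvg_real_complex.
Qed.

Lemma cvgn_geometric_increments (u : nat -> R) (B r : R) : 0 <= r -> r < 1 ->
  (forall n, `|u n.+1 - u n| <= B * r ^+ n) -> cvgn u.
Proof.
move=> r_ge0 r_lt1 hu.
have /normed_cvg : cvgn [normed series (telescope u)].
  have h2 n : 0 <= geometric B r n by apply: le_trans (hu n).
  have h4 : cvgn (series (geometric B r)).
    by apply/is_cvg_geometric_series; rewrite ger0_norm.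
  exact: (series_le_cvg _ h2 hu h4).
move=> /cvg_ex [l hl]; apply/cvg_ex; exists (u 0%N + l).
have eu : u = fun n => u 0%N + series (telescope u) n.
  by apply/funext => n; exact: eq_sum_telescope.
rewrite {1}eu; exact: (cvgD (cvg_cst (u 0%N)) hl).
Qed.

Lemma cvgn_geometric_incrementsC (u : nat -> C) (B r : R) : 0 <= r -> r < 1 ->
  (forall n, `|u n.+1 - u n| <= (B * r ^+ n)%:C%C) -> cvgn u.
Proof.
move=> r_ge0 r_lt1 hu; apply: cvg_complexE.
  apply: (cvgn_geometric_increments (B := B) r_ge0 r_lt1) => n.
  rewrite -lecR (le_trans _ (hu n)) // -raddfB /=.
  exact: normc_ge_Re.
apply: (cvgn_geometric_increments (B := B) r_ge0 r_lt1) => n.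
rewrite -lecR (le_trans _ (hu n)) // -raddfB /=.
(* The imaginary part is bounded through the real part of the product with i, as Re(iz) = - Im z. *)
have := normc_ge_Re ((u n.+1 - u n) * 'i%C); rewrite ReiNIm normrN normrM.
by rewrite [X in _ * X]normc_def /= expr0n add0r expr1n sqrtr1 mulr1.
Qed.

End ComplexLimits.

(** * Convergence and non-vanishing of the infinite products *)

Section InfiniteProducts.
Variable R : realType.
Let C : numFieldType := R[i].
Implicit Types (a q : C).

(** From 1 + x <= exp x. The induction keeps the partial geometric sum in the exponent, which is
    then enlarged to its limit. *)
Lemma prod_geometric_bound (f : nat -> C) (c r : R) n : 0 <= c -> 0 <= r -> r < 1 ->
  (forall m, `|f m| <= (1 + c * r ^+ m)%:C%C) ->
  `|\prod_(0 <= m < n) f m| <= (expR (c / (1 - r)))%:C%C.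
Proof.
move=> c_ge0 r_ge0 r_lt1 hf.
have h : 0 < 1 - r by rewrite subr_gt0.
apply: (@le_trans _ _ (expR (c * ((1 - r ^+ n) / (1 - r))))%:C%C); last first.
  rewrite lecR ler_expR ler_wpM2l // -[leRHS]mul1r ler_pM2r ?invr_gt0 //.
  by rewrite gerBl exprn_ge0.
elim: n => [|n IH].
  by rewrite big_geq // normr1 expr0 subrr mul0r mulr0 expR0.
rewrite big_nat_recr //= normrM.
have -> : c * ((1 - r ^+ n.+1) / (1 - r)) = c * ((1 - r ^+ n) / (1 - r)) + c * r ^+ n.
  by rewrite exprS; field; exact: lt0r_neq0.
rewrite expRD rmorphM /= ler_pM //.
by rewrite (le_trans (hf n)) // lecR expR_ge1Dx.
Qed.

Lemma norm_expC_lt1 q n : `|q| < 1 -> `|q ^+ n.+1| < 1.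
Proof. by move=> q_lt1; rewrite normrX exprn_ilt1. Qed.

Lemma one_sub_expC_neq0 q n : `|q| < 1 -> 1 - q ^+ n.+1 != 0.
Proof.
move=> /(norm_expC_lt1 n) h; rewrite subr_eq0; apply/eqP => e.
by rewrite -e normr1 ltxx in h.
Qed.

Lemma qfin_bounded a q : `|q| < 1 -> exists B : R, forall n, `|qfin a q n| <= B%:C%C.
Proof.
have [r r_ge0 er] := norm_complexP q; have [c c_ge0 ec] := norm_complexP a.
rewrite er ltcR => r_lt1; exists (expR (c / (1 - r))) => n.
apply: prod_geometric_bound => // m.
rewrite (le_trans (ler_normB _ _)) // normr1 normrM normrX er ec.
by rewrite rmorphD rmorphM rmorphXn.
Qed.

(* 1 / (1 - x) <= 1 + x / (1 - r) for 0 <= x <= r, so the inverse product is again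
   dominated by a product of factors 1 + c r^m. *)
Lemma qqfin_inv_bounded q : `|q| < 1 -> exists B : R, forall n, `|(qfin q q n)^-1| <= B%:C%C.
Proof.
have [r r_ge0 er] := norm_complexP q.
rewrite er ltcR => r_lt1; exists (expR (r / (1 - r) / (1 - r))) => n.
have h : 0 < 1 - r by rewrite subr_gt0.
rewrite /qfin -prodfV; apply: prod_geometric_bound => // [|m].
  by rewrite divr_ge0 // ltW.
have hm : r ^+ m.+1 <= r.
  by rewrite exprS ler_piMr // exprn_ile1 // ltW.
have h1 : 0 < 1 - r ^+ m.+1 by rewrite subr_gt0 (le_lt_trans hm).
have h2 : (1 - r ^+ m.+1)%:C%C <= `|1 - q * q ^+ m|.
  rewrite -exprS (le_trans _ (lerB_dist _ _)) // normr1 normrX er.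
  by rewrite rmorphB rmorph1 rmorphXn.
rewrite normfV (@le_trans _ _ ((1 - r ^+ m.+1)^-1)%:C%C) //.
  have h3 : 0 < ((1 - r ^+ m.+1)%:C%C : C) by rewrite (ltcR 0).
  by rewrite fmorphV /= lef_pV2 // posrE // (lt_le_trans h3 h2).
rewrite lecR -(ler_pM2r h1) mulVf ?lt0r_neq0 //.
rewrite [leRHS](_ : _ = 1 + r ^+ m.+1 * (r - r ^+ m.+1) / (1 - r)); last first.
  by rewrite exprS; field; exact: lt0r_neq0.
by rewrite lerDl divr_ge0 ?mulr_ge0 ?exprn_ge0 ?subr_ge0 // ltW.
Qed.

(** Consecutive partial products differ by a q^n times a bounded quantity, so the increments decay
    geometrically. *)
Lemma cvg_qfin a q : `|q| < 1 -> qfin a q @ \oo --> (qpoch_inf a q : C).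
Proof.
move=> q_lt1; have [B hB] := qfin_bounded a q_lt1.
have [r r_ge0 er] := norm_complexP q; have [c c_ge0 ec] := norm_complexP a.
rewrite er ltcR in q_lt1.
have : cvgn (qfin a q : nat -> C).
  apply: (cvgn_geometric_incrementsC (B := B * c) r_ge0 q_lt1) => n.
  rewrite qfinS (_ : _ - _ = - (qfin a q n * (a * q ^+ n))); last by ring.
  rewrite normrN !normrM normrX er ec !rmorphM rmorphXn /= -mulrA ler_wpM2r ?hB //.
  by rewrite mulr_ge0 ?exprn_ge0 // ler0c.
by move=> h; exact: h.
Qed.

Lemma qpoch_inf_eq a q l : qfin a q @ \oo --> (l : C) -> qpoch_inf a q = l.
Proof. by move=> /cvg_lim; apply; exact: norm_hausdorff. Qed.

(** A limit equal to 0 would contradict the boundedness of the inverses of the partial products. *)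
Lemma qqpoch_inf_neq0 q : `|q| < 1 -> qpoch_inf q q != 0.
Proof.
move=> q_lt1; have [B hB] := qqfin_inv_bounded q_lt1.
have B_gt0 : 0 < (B%:C%C : C).
  by apply: lt_le_trans (hB 0%N); rewrite qfin0 invr1 normr1.
apply/eqP => e.
have := cvg_qfin (a := q) q_lt1; rewrite e => /cvgrPdist_lt /(_ (B%:C%C)^-1).
rewrite invr_gt0 => /(_ B_gt0) [n _ /(_ n (leqnn n))].
rewrite /= sub0r normrN; apply/negP; rewrite -real_leNgt ?ger0_real ?invr_ge0 ?(ltW B_gt0) //.
rewrite -[X in _ <= X]invrK -normfV lef_pV2 // posrE normr_gt0 invr_eq0.
by apply: qqfin_neq0 => m; exact: one_sub_expC_neq0.
Qed.

Lemma qfinD a q n m : qfin a q (n + m) = qfin a q n * qfin (a * q ^+ n) q m.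
Proof.
elim: m => [|m IH]; first by rewrite addn0 qfin0 mulr1.
by rewrite addnS !qfinS IH exprD; ring.
Qed.

Lemma qpoch_inf_split a q n : `|q| < 1 -> qpoch_inf a q = qfin a q n * qpoch_inf (a * q ^+ n) q.
Proof.
move=> q_lt1; apply: qpoch_inf_eq; rewrite -(cvg_shiftn n).
under eq_fun do rewrite addnC qfinD.
by apply: cvgMr; exact: cvg_qfin.
Qed.

(** The denominator in [qpoch] is a factor of (q; q)_oo, hence nonzero, and may be cancelled. *)
Lemma qpochE q n : `|q| < 1 -> qpoch q q n = qfin q q n.
Proof.
move=> q_lt1; rewrite /qpoch.
have := qqpoch_inf_neq0 q_lt1; rewrite (qpoch_inf_split q n q_lt1) mulf_eq0 negb_or.
by move=> /andP[_ h]; rewrite mulfK.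
Qed.

End InfiniteProducts.

(** For [P] = (q; q)_oo the constant [P^-1 * P^-1] is the limit of [kern0] in its first argument;
    the limit of plain coefficient sums [S] is thus read off from that of the kernel sums [T]. *)
Lemma cvg_asymp (K : numFieldType) (S T : nat -> K) (a P : K) : P != 0 ->
  T @ \oo --> a -> (fun n => T n - S n * (P^-1 * P^-1)) @ \oo --> (0 : K) ->
  S @ \oo --> a * (P * P).
Proof.
move=> P_neq0 hT hS; have := cvgM (cvgB hT hS) (cvg_cst (P * P)).
have -> : (T - (fun n => T n - S n * (P^-1 * P^-1))) \* (fun=> P * P) = S.
  apply/funext => n; transitivity ((T n - (T n - S n * (P^-1 * P^-1))) * (P * P)) => //.
  by rewrite opprB addrC subrK -mulrA -invfM mulVf ?mulr1 // mulf_neq0.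
by rewrite subr0 => h; exact: h.
Qed.

(** * Limits of the kernels and the Jacobi triple product *)

Section Limits.
Variable R : realType.
Let C : numFieldType := R[i].
Variable q : C.
Hypothesis q_lt1 : `|q| < 1.

Let q_neq1 n : 1 - q ^+ n.+1 != 0.
Proof. exact: one_sub_expC_neq0. Qed.

Lemma cvg_qqfin_inv : (fun n => (qfin q q n)^-1) @ \oo --> (qpoch_inf q q)^-1.
Proof. by apply: cvgV; [exact: qqpoch_inf_neq0 | exact: cvg_qfin]. Qed.

Lemma cvg_qinv s : (fun n => qinv q n s) @ \oo --> (qpoch_inf q q)^-1.
Proof.
rewrite -(cvg_shiftn s); under eq_fun do rewrite qinvDn.
exact: cvg_qqfin_inv.
Qed.

Lemma cvg_kern0 m : (fun n => kern0 q n m) @ \oo --> (qpoch_inf q q)^-1 * (qpoch_inf q q)^-1.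
Proof.
apply: cvgM; first exact: cvg_qinv.
have := cvg_qqfin_inv; rewrite -(cvg_shiftn m); exact.
Qed.

Lemma qinv_bounded : exists2 B : C, 0 <= B & forall n s, `|qinv q n s| <= B.
Proof.
have [B hB] := qqfin_inv_bounded q_lt1; exists (B%:C%C).
  exact: le_trans (hB 0%N).
by move=> n s; rewrite /qinv; case: ifP => _; [exact: hB | rewrite normr0 (le_trans _ (hB 0%N))].
Qed.

(** Stated as a difference so that it can be used both ways: [cvg_jacobi] deduces the limit of the
    coefficient sums from that of the kernel sums, [cvg_iter_sum] the converse. *)
Lemma cvg_sum_kern0 (a : nat -> C) (B : C) :
  (forall m, `|a m| <= B * `|q| ^+ m.-1) ->
  (fun n => \sum_(0 <= m < n.+1) a m * kern0 q n m
            - (\sum_(0 <= m < n.+1) a m) * ((qpoch_inf q q)^-1 * (qpoch_inf q q)^-1))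
    @ \oo --> (0 : C).
Proof.
move=> ha; set L := (qpoch_inf q q)^-1.
have [B' B'_ge0 hB'] := qinv_bounded.
have B_ge0 : 0 <= B by have := ha 0%N; rewrite expr0 mulr1; apply: le_trans.
have -> : (fun n => \sum_(0 <= m < n.+1) a m * kern0 q n m - (\sum_(0 <= m < n.+1) a m) * (L * L))
  = (fun n => \sum_(0 <= m < n.+1) a m * (kern0 q n m - L * L)).
  apply/funext => n; rewrite mulr_suml -sumrB; apply: eq_bigr => m _; ring.
apply: (@tannery C `|q| _ _ _ _ (B * (B' * B' + `|L * L|))) => //.
- by apply: cvg_expC; rewrite normr_id.
- move=> n m; rewrite normrM [leRHS]mulrAC ler_pM // (le_trans (ler_normB _ _)) // lerD2r.
  rewrite /kern0 normrM ler_pM //.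
  by have := hB' (n + m)%N 0%N; rewrite qinvn0.
- move=> m; rewrite -(mulr0 (a m)) -(subrr (L * L)).
  by apply: cvgMr; apply: cvgB; [exact: cvg_kern0|exact: cvg_cst].
Qed.

Lemma jacobi_coef_bound (x y : C) m : `|x| <= 1 -> `|y| <= 1 ->
  `|jacobi_coef q x y m| <= 2 * `|q| ^+ m.-1.
Proof.
move=> x1 y1; rewrite /jacobi_coef; case: m => [|m].
  by rewrite normr1 expr0 mulr1 ler1n.
rewrite mulrC !normrM normrX normrN1 expr1n mul1r ler_pM //.
  rewrite (le_trans (ler_normD _ _)) // !normrX -[2]/(1 + 1) lerD // exprn_ile1 //.
by rewrite normrX ler_wiXn2l // ?ltW //= binS bin1 leq_addl.
Qed.

(** Limit of [jacobi_finite]: its right-hand side tends to (x)_oo (y)_oo / (q)_oo, and removing the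
    limit of the kernel multiplies by the square of (q)_oo. *)
Lemma cvg_jacobi (x y : C) : x * y = q -> `|x| <= 1 -> `|y| <= 1 ->
  (fun n => \sum_(0 <= m < n.+1) jacobi_coef q x y m) @ \oo --> (qpochs_inf [:: q; x; y] q : C).
Proof.
move=> xy x1 y1; set P := qpoch_inf q q.
have P_neq0 : P != 0 by exact: qqpoch_inf_neq0.
have h1 := cvg_sum_kern0 (fun m => jacobi_coef_bound m x1 y1).
have h2 : (fun n => \sum_(0 <= m < n.+1) jacobi_coef q x y m * kern0 q n m) @ \oo -->
   (qpoch_inf x q * qpoch_inf y q * P^-1 : C).
  under eq_fun do rewrite (jacobi_finite q_neq1 _ xy).
  apply: cvgM; first by apply: cvgM; exact: cvg_qfin.
  have : (fun n => n.*2) @ \oo --> \oo.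
    move=> A [N _ hN]; exists N => // n /= le_Nn; apply: hN => /=.
    by rewrite (leq_trans le_Nn) // -addnn leq_addr.
  move=> h; exact: (cvg_comp _ _ h cvg_qqfin_inv).
have := cvg_asymp P_neq0 h2 h1.
rewrite /qpochs_inf !big_cons big_nil mulr1 -/P.
by rewrite (_ : _ / P * (P * P) = P * (qpoch_inf x q * qpoch_inf y q)); last by field.
Qed.

End Limits.

(** * Binomial expansion of the final alpha-sequence into theta coefficients *)

Lemma bin2_double m : ('C(m, 2) * 2 = m ^ 2 - m)%N.
Proof. by elim: m => [//|m IH]; rewrite binS bin1 mulnDl IH; nia. Qed.

Section Coefficients.
Variables (F : fieldType) (q : F).
Hypothesis q1_neq0 : 1 + q != 0.

(** For m > 0 and z = q^(2m), [alpha] contains the groups z^r (1 + qz) and z + q. The power (1 +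
    z)^j is expanded in z^s against the first and in z^(j-s) against the second; each resulting
    monomial is one half of a Jacobi coefficient. *)
Lemma alpha_bailey_mult (D : seq nat) k r m : (r <= k)%N -> uniq D ->
  (forall i, i \in D -> (1 <= i <= k - r)%N) ->
  let Q := q ^+ (2 * k + 2) in let j := size D in
  alpha q r m * \prod_(1 <= i < (k - r).+1) bailey_mult q D i m
  = 1 / (1 + q) * \sum_(0 <= s < j.+1) 'C(j, s)%:R *
     (jacobi_coef Q (q ^+ (k + 2 - r + j - 2 * s)) (q ^+ (k + r - j + 2 * s)) m
      + q * jacobi_coef Q (q ^+ (k - r + j - 2 * s)) (q ^+ (k + 2 + r - j + 2 * s)) m).
Proof.
move=> le_rk uD hD Q j.
have le_jt : (j <= k - r)%N := size_sub_iota uD hD.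
have D_le i : i \in D -> (i <= k - r)%N by move=> /hD/andP[].
rewrite (prod_bailey_mult _ D_le) //; last by move=> i /hD/andP[].
rewrite -/j; case: m => [|m].
  (* At m = 0 all Jacobi coefficients are 1 and both sides equal 2^j. *)
  rewrite /= mulr1 muln0 subn0 muln0 expr0 mul1r mul1r.
  rewrite -mulr_suml mulrCA divfK // mulr1.
  rewrite exprDn big_mkord; apply: eq_bigr => s _.
  by rewrite !expr1n mul1r.
set z := q ^+ m.+1.*2; set e := q ^+ (k.+1 * (m.+1 ^ 2 - m.+1) + (k - r - j) * m.+1).
have zX n : z ^+ n = q ^+ (n * m.+1.*2) by rewrite -exprM mulnC.
(* All exponents have this shape: z^a comes from the group in [alpha], z^b from the binomial
   expansion. *)
have E n a b : (n = k - r - j + 2 * a + 2 * b)%N ->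
    Q ^+ 'C(m.+1, 2) * q ^+ n ^+ m.+1 = e * z ^+ a * z ^+ b.
  move=> ->; rewrite !zX -!exprM -!exprD; congr (q ^+ _).
  by have := bin2_double m.+1; move: 'C(m.+1, 2) => c; nia.
have S1 : \sum_(0 <= s < j.+1) 'C(j, s)%:R * z ^+ s = (1 + z) ^+ j.
  rewrite exprDn big_mkord; apply: eq_bigr => s _.
  by rewrite expr1n mul1r mulr_natl.
have S2 : \sum_(0 <= s < j.+1) 'C(j, s)%:R * z ^+ (j - s) = (1 + z) ^+ j.
  rewrite addrC exprDn big_mkord; apply: eq_bigr => s _.
  by rewrite expr1n mulr1 mulr_natl.
rewrite (eq_big_nat _ _ (F2 := fun s => (-1) ^+ m.+1 * e * (z + q) * ('C(j, s)%:R * z ^+ (j - s))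
   + (-1) ^+ m.+1 * e * (z ^+ r * (1 + q * z)) * ('C(j, s)%:R * z ^+ s))).
  rewrite big_split /= -!mulr_sumr S1 S2.
  have -> : e = q ^+ (r.+1 * (m.+1 ^ 2 - m.+1)) * q ^+ ((k - r) * m.+1 ^ 2 - j * m.+1).
    by rewrite -exprD; congr (q ^+ _); nia.
  by rewrite zX (exprS q m.+1.*2) -/z; field.
move=> s /andP[_ le_sj].
have E1 := E (k + 2 - r + j - 2 * s)%N 1%N (j - s)%N.
have E2 := E (k + r - j + 2 * s)%N r s.
have E3 := E (k - r + j - 2 * s)%N 0%N (j - s)%N.
have E4 := E (k + 2 + r - j + 2 * s)%N r.+1 s.
rewrite /jacobi_coef -!mulrA !mulrDr !E1 ?E2 ?E3 ?E4; try lia.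
by rewrite (exprS z r) !expr0 expr1; ring.
Qed.

End Coefficients.

(** * Absolute bounds for iterated sums *)

Section IterSumBounds.
Variables (K : numFieldType) (w : nat -> nat -> nat -> K) (b : nat -> K).

Definition abs_weight i n s : K := `|w i n s|.
Definition abs_base n : K := `|b n|.

Lemma norm_iter_sum k i n : `|iter_sum w b k i n| <= iter_sum abs_weight abs_base k i n.
Proof.
elim: k i n => [|k IH] i n //=.
rewrite (le_trans (ler_norm_sum _ _ _)) // ler_sum // => s _.
by rewrite normrM ler_wpM2l.
Qed.

Lemma abs_iter_sum_ge0 k i n : 0 <= iter_sum abs_weight abs_base k i n.
Proof. exact: le_trans (norm_iter_sum k i n). Qed.

Lemma abs_iter_sum_bound (W B : K) :
  (forall i n, \sum_(0 <= s < n.+1) `|w i n s| <= W) -> (forall n, `|b n| <= B) ->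
  forall k i n, iter_sum abs_weight abs_base k i n <= W ^+ k * B.
Proof.
move=> hW hB; elim=> [|k IH] i n /=; first by rewrite expr0 mul1r; exact: hB.
have B_ge0 : 0 <= B by exact: le_trans (hB 0%N).
have W_ge0 : 0 <= W by apply: le_trans (hW 0%N 0%N); rewrite sumr_ge0.
apply: (@le_trans _ _ (\sum_(0 <= s < n.+1) `|w i n s| * (W ^+ k * B))).
  by apply: ler_sum => s _; apply: ler_wpM2l; [exact: normr_ge0 | exact: IH].
by rewrite -mulr_suml exprS -mulrA ler_wpM2r // mulr_ge0 // exprn_ge0.
Qed.

End IterSumBounds.

(** * The limit of the iterated sum as the outer bound tends to infinity *)

Section MainLimit.
Variable R : realType.
Let C : numFieldType := R[i].
Variables (q : C) (D : seq nat) (k r : nat).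
Hypotheses (q_lt1 : `|q| < 1) (le_rk : (r <= k)%N) (k_gt0 : (0 < k)%N).
Hypotheses (uD : uniq D) (hD : forall i, i \in D -> (1 <= i <= k - r)%N).

Let q_neq1 n : 1 - q ^+ n.+1 != 0.
Proof. exact: one_sub_expC_neq0. Qed.

Let q1_neq0 : 1 + q != 0.
Proof.
rewrite addrC addr_eq0; apply/eqP => e.
by have := q_lt1; rewrite e normrN1 ltxx.
Qed.

Let w := weight q D (k - r).
Let b := base q.
Let top := top_weight q D (k - r).
Let P : C := qpoch_inf q q.
Let P_neq0 : P != 0. Proof. exact: qqpoch_inf_neq0. Qed.
Let side : C := product_side k r (size D) q.
Let coef m : C := alpha q r m * \prod_(1 <= i < (k - r).+1) bailey_mult q D i m.

Let expn_norm_le1 n : `|q ^+ n| <= 1.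
Proof. by rewrite normrX exprn_ile1 // ltW. Qed.

Let Q_lt1 : `|q ^+ (2 * k + 2)| < 1.
Proof. by rewrite addnS; exact: norm_expC_lt1. Qed.

Lemma cvg_coef : (fun n => \sum_(0 <= m < n.+1) coef m) @ \oo --> side * P.
Proof.
set Q := q ^+ (2 * k + 2); set j := size D.
have le_jt : (j <= k - r)%N := size_sub_iota uD hD.
pose J1 s := jacobi_coef Q (q ^+ (k + 2 - r + j - 2 * s)) (q ^+ (k + r - j + 2 * s)).
pose J2 s := jacobi_coef Q (q ^+ (k - r + j - 2 * s)) (q ^+ (k + 2 + r - j + 2 * s)).
have -> : (fun n => \sum_(0 <= m < n.+1) coef m) =
  fun n => 1 / (1 + q) * \sum_(0 <= s < j.+1) 'C(j, s)%:R *
     (\sum_(0 <= m < n.+1) J1 s m + q * \sum_(0 <= m < n.+1) J2 s m).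
  apply/funext => n.
  under eq_bigr => m _ do rewrite /coef (alpha_bailey_mult q1_neq0 _ le_rk uD hD).
  rewrite -mulr_sumr exchange_big_nat /=; congr (_ * _); apply: eq_bigr => s _.
  by rewrite -mulr_sumr big_split /= mulr_sumr.
rewrite /side /product_side -(mulrA (1 / (1 + q)) _ P) mulr_suml; apply: cvgMr.
apply: cvg_sum_nat => s lt_sj; rewrite -mulrA mulrDl -(mulrA q) !divfK //; apply: cvgMr.
(* The triple product is taken in base q^(2k+2), to which the exponents of x and y add up. One of
   these exponents may be 0, whence the non-strict norm bounds. *)
apply: cvgD; last apply: cvgMr.
  by apply: (cvg_jacobi Q_lt1 _ (expn_norm_le1 _) (expn_norm_le1 _));
    rewrite -exprD; congr (q ^+ _); lia.
by apply: (cvg_jacobi Q_lt1 _ (expn_norm_le1 _) (expn_norm_le1 _));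
    rewrite -exprD; congr (q ^+ _); lia.
Qed.

Lemma coef_bound : exists B : C, forall m, `|coef m| <= B * `|q| ^+ m.-1.
Proof.
set j := size D.
exists (`|1 / (1 + q)| * \sum_(0 <= s < j.+1) 'C(j, s)%:R * (2 + `|q| * 2)) => m.
rewrite /coef (alpha_bailey_mult q1_neq0 _ le_rk uD hD) -/j normrM -mulrA ler_wpM2l //.
rewrite mulr_suml (le_trans (ler_norm_sum _ _ _)) // ler_sum // => s _.
rewrite normrM normr_nat -mulrA ler_wpM2l //.
have h x y : `|jacobi_coef (q ^+ (2 * k + 2)) (q ^+ x) (q ^+ y) m| <= 2 * `|q| ^+ m.-1.
  apply: le_trans (jacobi_coef_bound Q_lt1 _ (expn_norm_le1 _) (expn_norm_le1 _)) _.
  apply: ler_wpM2l; first exact: ler0n.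
  rewrite normrX -exprM; apply: ler_wiXn2l; [exact: normr_ge0 | exact: ltW |].
  by rewrite leq_pmull // addnS.
by rewrite (le_trans (ler_normD _ _)) // normrM mulrDl -mulrA lerD // ler_wpM2l.
Qed.

Lemma cvg_iter_sum : iter_sum w b k 1 @ \oo --> side * P * (P^-1 * P^-1).
Proof.
have [B hB] := coef_bound.
have h := cvg_sum_kern0 q_lt1 hB.
have D_le i : i \in D -> (i <= k - r)%N by move=> /hD/andP[].
have e n : iter_sum w b k 1 n = \sum_(0 <= m < n.+1) coef m * kern0 q n m.
  by rewrite -(iter_sum_kern0 D_le q_neq1 q1_neq0) subnK.
have -> : iter_sum w b k 1 = fun n => (\sum_(0 <= m < n.+1) coef m * kern0 q n m
    - (\sum_(0 <= m < n.+1) coef m) * (P^-1 * P^-1))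
    + (\sum_(0 <= m < n.+1) coef m) * (P^-1 * P^-1).
  by apply/funext => n; rewrite e subrK.
rewrite -[X in _ --> X]add0r; apply: cvgD; first exact: h.
by apply: cvgMl; exact: cvg_coef.
Qed.

Lemma top_weight_bound i s : `|top i s| <= `|q| ^+ s.-1.
Proof.
rewrite normrX ler_wiXn2l // ?ltW //.
by case: (i \in D); case: (_ < i)%N; rewrite ?mul1n ?mul0n; nia.
Qed.

Lemma weight_bound : exists2 B : C, 0 <= B & forall i n s, `|w i n s| <= B * `|q| ^+ s.-1.
Proof.
have [B B_ge0 hB] := qinv_bounded q_lt1; exists (2 * B); first by rewrite mulr_ge0.
move=> i n s; rewrite /w /weight !normrM (_ : 2 * B * _ = `|q| ^+ s.-1 * 2 * B); last by ring.
apply: ler_pM; [exact: mulr_ge0 | exact: normr_ge0 | | exact: hB].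
apply: ler_pM; [exact: normr_ge0 | exact: normr_ge0 | exact: top_weight_bound |].
rewrite /shift_factor; case: ifP => _; last by rewrite normr1 ler1n.
by rewrite (le_trans (ler_normD _ _)) // normr1 -[2]/(1 + 1) lerD2l.
Qed.

(** The factor 1 + q^(n+s) tends to 1, which is why the extra factor of index 1 is q^(-s_1)
    alone. *)
Lemma cvg_weight i s : (fun n => w i n s) @ \oo --> top i s * P^-1.
Proof.
apply: cvgM; last exact: cvg_qinv.
rewrite -[X in _ --> X]mulr1; apply: cvgMr.
rewrite /shift_factor; case: (i \in D); last exact: (cvg_cst (1 : C)).
have h : (fun n => q ^+ (n + s)) @ \oo --> (0 : C).
  by have := cvg_expC q_lt1; rewrite -(cvg_shiftn s); exact.
rewrite -[X in _ --> X]addr0; exact: (cvgD (cvg_cst (1 : C)) h).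
Qed.

Lemma base_bound : exists2 B : C, 0 <= B & forall n, `|b n| <= B.
Proof.
have q2_lt1 : `|q ^+ 2| < 1 by exact: norm_expC_lt1.
have [B hB] := qqfin_inv_bounded q2_lt1; exists (B%:C%C); first exact: le_trans (hB 0%N).
move=> n; rewrite /b /base normrM -[leRHS]mul1r.
by apply: ler_pM; [exact: normr_ge0 | exact: normr_ge0 | exact: expn_norm_le1 | exact: hB].
Qed.

Lemma tail_bound : exists2 B : C, 0 <= B & forall s,
  iter_sum (abs_weight w) (abs_base b) k.-1 2 s <= B.
Proof.
have [W W_ge0 hW] := weight_bound; have [B B_ge0 hB] := base_bound.
have V_ge0 : 0 <= W * (1 + (1 - `|q|)^-1).
  by rewrite mulr_ge0 // addr_ge0 // invr_ge0 subr_ge0 ltW.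
exists ((W * (1 + (1 - `|q|)^-1)) ^+ k.-1 * B); first by rewrite mulr_ge0 // exprn_ge0.
move=> s; apply: abs_iter_sum_bound => // i n.
rewrite (le_trans (ler_sum _ (fun s _ => hW i n s))) // -mulr_sumr ler_wpM2l //.
exact: geometric_sum.
Qed.

(** By [tannery] the weight of s_1 may be replaced by its limit, which includes 1/(q)_oo;
    multiplication by [P] then removes the last power of (q)_oo from [cvg_iter_sum]. *)
Lemma cvg_top_sum :
  (fun n => \sum_(0 <= s < n.+1) top 1%N s * iter_sum w b k.-1 2 s) @ \oo --> side.
Proof.
have [W W_ge0 hW] := weight_bound; have [B B_ge0 hB] := tail_bound.
set X := fun n => _.
have h : (fun n => iter_sum w b k 1 n - X n * P^-1) @ \oo --> (0 : C).
  have -> : (fun n => iter_sum w b k 1 n - X n * P^-1) =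
     fun n => \sum_(0 <= s < n.+1) (w 1%N n s - top 1%N s * P^-1) * iter_sum w b k.-1 2 s.
    apply/funext => n; rewrite /X -(prednK k_gt0) /= mulr_suml -sumrB.
    by apply: eq_bigr => s _; ring.
  apply: (@tannery C `|q| _ _ _ _ ((W + `|P^-1|) * B)) => //.
  - by apply: cvg_expC; rewrite normr_id.
  - move=> n s; rewrite normrM [leRHS]mulrAC ler_pM //; last first.
      by rewrite (le_trans (norm_iter_sum _ _ _ _ _)).
    rewrite (le_trans (ler_normB _ _)) // mulrDl lerD // normrM mulrC ler_wpM2l //.
    exact: top_weight_bound.
  - move=> s; rewrite -(mul0r (iter_sum w b k.-1 2 s)) -(subrr (top 1%N s * P^-1)).
    by apply: cvgMl; apply: cvgB; [exact: cvg_weight | exact: cvg_cst].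
have -> : X = fun n => (iter_sum w b k 1 n - (iter_sum w b k 1 n - X n * P^-1)) * P.
  by apply/funext => n; rewrite opprB addrC subrK divfK.
have -> : side = (side * P * (P^-1 * P^-1) - 0) * P by field.
by apply: cvgMl; apply: cvgB; [exact: cvg_iter_sum | exact: h].
Qed.

End MainLimit.

(** * Unconditional summation over chains *)

(** Any finite set containing [A n] is the union of [A n] and a set disjoint from it, whose
    contribution is at most [T n]. *)
Lemma has_sum_exhaust (K : numFieldType) (I : choiceType) (x : I -> K) (l : K)
    (A : nat -> {fset I}) (T : nat -> K) :
  (fun n => \sum_(i <- A n) x i) @ \oo --> l -> T @ \oo --> (0 : K) ->
  (forall n (J : {fset I}), [disjoint A n & J]%fset -> `|\sum_(i <- J) x i| <= T n) ->
  has_sum x l.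
Proof.
have FF : ProperFilter (@totally I) := totally_filter.
move=> hA hT hJ; apply/cvgrPdist_lt => e e_gt0.
have e2_gt0 : 0 < e / 2 by rewrite divr_gt0.
move/cvgrPdist_lt : hA => /(_ _ e2_gt0) hA.
move/cvgrPdist_lt : hT => /(_ _ e2_gt0) hT.
have [n [hAn hTn]] := filter_ex (filterI hA hT).
exists (A n) => // J /= sub_AJ.
have -> : partial_sum x J = \sum_(i <- A n) x i + \sum_(i <- (J `\` A n)%fset) x i.
  rewrite /partial_sum -(big_seq_fsetE _ _ xpredT) /= (big_fsetID _ (mem (A n))) /=.
  congr (_ + _); apply: eq_fbigl => i.
  - rewrite !inE /=; case: (boolP (i \in A n)) => [iA|]; last by rewrite andbF.
    by rewrite (fsubsetP sub_AJ).
  - by rewrite !inE andbC.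
rewrite opprD addrA (le_lt_trans (ler_normB _ _)) // [e]splitr ltr_leD //.
have dJ : [disjoint A n & J `\` A n]%fset by apply/fdisjointP => i iA; rewrite !inE iA.
apply: le_trans (hJ n _ dJ) _; move: hTn; rewrite /= sub0r normrN ger0_norm; first exact: ltW.
exact: le_trans (hJ n fset0 (fdisjointX0 _)).
Qed.

(** The enumeration follows the nesting of [iter_sum], so that sums over it unfold level by
    level. *)
Fixpoint chains k n : seq (seq nat) :=
  if k is k'.+1 then flatten [seq [seq s :: l | l <- chains k' s] | s <- index_iota 0 n.+1]
  else [:: [::]].

Fixpoint chain_weight (F : fieldType) (w : nat -> nat -> nat -> F) (b : nat -> F) i n l : F :=
  if l is s :: l' then w i n s * chain_weight w b i.+1 s l' else b n.

Lemma chainsS k n :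
  chains k.+1 n = flatten [seq [seq s :: l | l <- chains k s] | s <- index_iota 0 n.+1].
Proof. by []. Qed.

Lemma mem_chains k n l : (l \in chains k n) = (size l == k) && path geq n l.
Proof.
elim: k n l => [|k IH] n l; [by case: l | rewrite chainsS].
apply/idP/idP => [/flattenP[L /mapP[s hs ->] /mapP[l' hl' ->]]|].
  by move: hl' hs; rewrite IH mem_index_iota /= eqSS ltnS => /andP[-> ->] ->.
case: l => [//|s l]; rewrite [size _]/= [path _ _ _]/= eqSS => /and3P[sl le_sn pl].
apply/flattenP; exists [seq s :: l' | l' <- chains k s].
  by apply/mapP; exists s => //; rewrite mem_index_iota ltnS.
by apply/mapP; exists l => //; rewrite IH sl pl.
Qed.

Lemma chains_uniq k n : uniq (chains k n).
Proof.
elim: k n => [//|k IH] n; rewrite chainsS.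
elim: (index_iota 0 n.+1) (iota_uniq 0 (n.+1 - 0) : uniq (index_iota 0 n.+1)) => [//|s t IHt].
move=> /= /andP[st ut].
rewrite cat_uniq IHt // andbT map_inj_uniq ?IH /=; last by move=> ? ? [].
apply/hasPn => l /flattenP[L /mapP[s' hs' ->] /mapP[l' _ ->]].
apply/mapP => -[l'' _ [e _]]; by rewrite -e hs' in st.
Qed.

Lemma sum_chainsS (V : zmodType) (f : seq nat -> V) k n :
  \sum_(l <- chains k.+1 n) f l
  = \sum_(0 <= s < n.+1) \sum_(l <- chains k s) f (s :: l).
Proof. by rewrite chainsS big_flatten big_map; apply: eq_bigr => s _; rewrite big_map. Qed.

Lemma sum_chain_weight (F : fieldType) (w : nat -> nat -> nat -> F) b k i n :
  \sum_(l <- chains k n) chain_weight w b i n l = iter_sum w b k i n.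
Proof.
elim: k i n => [|k IH] i n; first by rewrite big_seq1.
rewrite sum_chainsS /=; apply: eq_bigr => s _.
by rewrite -mulr_sumr IH.
Qed.

Lemma norm_chain_weight (K : numFieldType) (w : nat -> nat -> nat -> K) b i n l :
  `|chain_weight w b i n l| = chain_weight (abs_weight w) (abs_base b) i n l.
Proof. by elim: l i n => [//|s l IH] i n /=; rewrite normrM IH. Qed.

Lemma chain_weightE (F : fieldType) (w : nat -> nat -> nat -> F) b i n l :
  chain_weight w b i n l =
  (\prod_(0 <= t < size l) w (i + t)%N (nth 0%N (n :: l) t) (nth 0%N l t)) * b (last n l).
Proof.
elim: l i n => [|s l IH] i n /=; first by rewrite big_geq // mul1r.
rewrite big_nat_recl // addn0 IH mulrA; congr (_ * _ * _).
by apply: eq_bigr => t _; rewrite addSnnS.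
Qed.

Lemma sum_uniq_sub (K : numDomainType) (T : eqType) (s L : seq T) (g : T -> K) :
  uniq s -> uniq L -> {subset s <= L} -> (forall x, 0 <= g x) ->
  \sum_(x <- s) g x <= \sum_(x <- L) g x.
Proof.
move=> us uL sL g_ge0.
have p : perm_eq s [seq x <- L | x \in s].
  apply: uniq_perm => //; first exact: filter_uniq.
  by move=> x; rewrite mem_filter; case: (boolP (x \in s)) => // /sL ->.
rewrite (perm_big _ p) /= big_filter big_mkcond /=.
by apply: ler_sum => x _; case: ifP.
Qed.

(** * Identification of the multisum with the iterated sum, and its unconditional convergence *)

Section MainTheorem.
Variable R : realType.
Let C : numFieldType := R[i].
Variables (q : C) (D : seq nat) (k r : nat).
Hypotheses (q_lt1 : `|q| < 1) (le_rk : (r <= k)%N) (k_gt0 : (0 < k)%N).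
Hypotheses (uD : uniq D) (hD : forall i, i \in D -> (1 <= i <= k - r)%N).

Let w := weight q D (k - r).
Let b := base q.
Let top := top_weight q D (k - r).

(* The outermost variable s_1 has no predecessor: its weight is the limit of
   (q)_oo * weight 1 n s_1 as n tends to infinity. *)
Definition head_weight (l : seq nat) : C :=
  if l is s :: l' then top 1%N s * chain_weight w b 2 s l' else 0.

Lemma head_weightE (l : seq nat) : size l = k ->
  let e i := nth 0%N l i.-1 in
  head_weight l = (\prod_(1 <= i < k.+1) top i (e i))
    * (\prod_(2 <= i < k.+1) shift_factor q D i (e i.-1) (e i))
    * (\prod_(1 <= i < k) qinv q (e i) (e i.+1)) * b (e k).
Proof.
case: l => [/= k0|s l /= sz]; first by move: k_gt0; rewrite -k0.
rewrite chain_weightE -sz -nth_last /=.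
have -> : nth s l (size l).-1 = nth 0%N (s :: l) (size l).
  by case: l sz => [//|s' l] sz /=; rewrite (set_nth_default 0%N).
rewrite [\prod_(1 <= i < (size l).+2) _]big_ltn //= !mulrA; congr (_ * _).
rewrite -!mulrA; congr (_ * _); rewrite !mulrA.
rewrite !big_add1 /= -!big_split /=.
by congr (_ * _).
Qed.

Lemma multisum_termE (s : chain k) : multisum_term r q D s = head_weight (val (val s)).
Proof.
case: s => -[l szl] sl /=; have sz := eqP szl; rewrite head_weightE //.
rewrite /multisum_term /entry /=; set e := fun i => nth 0%N l i.-1.
have hDk i : i \in D -> (1 <= i <= k)%N by move=> /hD; lia.
have pD := perm_filter_iota uD hDk.
have -> : \prod_(1 <= i < k) qpoch q q (nth 0%N l i.-1 - nth 0%N l i)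
    * qpoch (q ^+ 2) (q ^+ 2) (nth 0%N l k.-1)
  = (\prod_(1 <= i < k) qinv q (e i) (e i.+1))^-1 * qfin (q ^+ 2) (q ^+ 2) (e k).
  rewrite qpochE; last exact: norm_expC_lt1.
  congr (_ * _); rewrite -prodfV; apply: eq_big_nat => i /andP[i_gt0 lt_ik].
  (* The entries decrease, so [qinv] is on its nonzero branch. *)
  rewrite qpochE // /qinv /e /= (_ : _ <= _)%N ?invrK //.
  have /(sortedP 0%N) hs := sl; have := hs i.-1; rewrite prednK //= sz => h; exact: h.
have -> : \prod_(i <- D | (2 <= i)%N) (1 + q ^+ (nth 0%N l i.-2 + nth 0%N l i.-1))
  = \prod_(2 <= i < k.+1) shift_factor q D i (e i.-1) (e i).
  rewrite (perm_big _ pD) /= big_filter_cond big_ltn_cond //= andbF.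
  rewrite big_mkcond [RHS]big_nat [LHS]big_nat; apply: eq_bigr => i /andP[i_ge2 _].
  by rewrite i_ge2 andbT.
(* The integer exponent is a natural number: [D] has no repetitions, and each subtracted s_i is
   absorbed by its own s_i^2. *)
have -> : q ^ ((\sum_(1 <= i < k.+1) nth 0%N l i.-1 ^ 2
          + \sum_(k - r + 1 <= i < k.+1) nth 0%N l i.-1
          + nth 0%N l k.-1)%N%:Z - (\sum_(i <- D) nth 0%N l i.-1)%N%:Z)
  = (\prod_(1 <= i < k.+1) top i (e i)) * q ^+ e k.
  rewrite /top /top_weight prodrXr -exprD.
  rewrite (_ : _ + _ + _ = \sum_(1 <= i < k.+1) (e i ^ 2 - (i \in D) * e i + (k - r < i) * e i)
       + e k + \sum_(i <- D) nth 0 l i.-1)%N.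
    by rewrite PoszD addrK.
  have dE : (\sum_(i <- D) nth 0 l i.-1 = \sum_(1 <= i < k.+1) (i \in D) * e i)%N.
    rewrite (perm_big _ pD) /= big_filter big_mkcond /=; apply: eq_bigr => i _.
    by case: (i \in D); rewrite ?mul1n.
  have lowE : (\sum_(k - r + 1 <= i < k.+1) nth 0 l i.-1
      = \sum_(1 <= i < k.+1) (k - r < i) * e i)%N.
    rewrite addn1 [RHS](big_cat_nat _ (n := (k - r).+1)) //=; last by rewrite ltnS leq_subr.
    rewrite [X in (X + _)%N]big_nat [X in (X + _)%N]big1 ?add0n; last first.
      by move=> i /andP[_]; rewrite ltnS leqNgt => /negbTE ->.
    apply: eq_big_nat => i /andP[-> _].
    by rewrite mul1n.
  rewrite dE lowE [RHS]addnAC; congr (_ + _)%N; rewrite -!big_split /=; apply: eq_bigr => i _.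
  by rewrite -/(e i); case: (i \in D); case: (_ < i)%N; rewrite ?mul1n ?mul0n; nia.
by rewrite /b /base invfM invrK; ring.
Qed.

Definition chains_le n : {fset chain k} := fset_set [set c : chain k | val (val c) \in chains k n].

Let entries (c : chain k) : seq nat := val (val c).

Lemma entries_inj : injective entries.
Proof. by move=> c d /val_inj /val_inj. Qed.

Lemma mem_chains_le n c : (c \in chains_le n) = (entries c \in chains k n).
Proof.
rewrite in_fset_set; first by apply/idP/idP => [/set_mem //|h]; exact: mem_set.
by apply: (@finite_preimage _ _ [set` chains k n] entries) => // ? ? _ _; exact: entries_inj.
Qed.

Lemma sum_chains_le n :
  \sum_(c <- chains_le n) head_weight (entries c) = \sum_(l <- chains k n) head_weight l.
Proof.
rewrite -(big_map entries xpredT head_weight); apply: perm_big; apply: uniq_perm.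
- by rewrite (map_inj_uniq entries_inj) fset_uniq.
- exact: chains_uniq.
move=> l; apply/mapP/idP => [[c hc ->]|hl]; first by rewrite -mem_chains_le.
have := hl; rewrite mem_chains => /andP[sz /path_sorted sl].
by exists (exist _ (Tuple sz) sl : chain k); rewrite ?mem_chains_le.
Qed.

(** A chain outside [chains_le n] has s_1 > n. Passing to absolute values, [J] is enlarged to all
    chains with n < s_1 <= N; the inner sums are at most [B], and the sum over s_1 is a geometric
    tail. *)
Lemma tail_le (B : C) n (J : {fset chain k}) :
  (forall s, iter_sum (abs_weight w) (abs_base b) k.-1 2 s <= B) ->
  [disjoint chains_le n & J]%fset ->
  `|\sum_(c <- J) head_weight (entries c)| <= `|q| ^+ n / (1 - `|q|) * B.
Proof.
move=> hB dJ; apply: le_trans (ler_norm_sum _ _ _) _.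
pose g l := if (head 0%N l <= n)%N then 0 else `|head_weight l|.
(* A sum of naturals bounds each of its terms, so every chain of [J] lies in [chains k N]. *)
pose N := (\sum_(c <- J) head 0%N (entries c))%N.
have entriesP (c : chain k) : exists s l, [/\ entries c = s :: l, size l = k.-1 & path geq s l].
  case: c => -[[|s l] szl] sl; have /= sz := eqP szl; first by exfalso; move: k_gt0; rewrite -sz.
  by exists s, l; split => //; rewrite -sz.
have -> : \sum_(c <- J) `|head_weight (entries c)| = \sum_(l <- map entries J) g l.
  rewrite big_map big_seq [RHS]big_seq; apply: eq_bigr => c cJ; rewrite /g.
  case: ifP => // le_n; have : c \notin chains_le n.
    by apply: contraL cJ => h; apply: (fdisjointP dJ).
  have [s [l [e sz sl]]] := entriesP c.
  rewrite mem_chains_le mem_chains e /= sz prednK // eqxx sl andbT.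
  by move: le_n; rewrite e /= => ->.
apply: (@le_trans _ _ (\sum_(l <- chains k N) g l)).
  apply: sum_uniq_sub.
  - by rewrite (map_inj_uniq entries_inj) fset_uniq.
  - exact: chains_uniq.
  - move=> _ /mapP[c cJ ->]; have [s [l [e sz sl]]] := entriesP c.
    rewrite mem_chains e /= sz prednK // eqxx sl andbT.
    by rewrite /N (big_fsetD1 c) //= e /= leq_addr.
  - by move=> l; rewrite /g; case: ifP.
have -> : \sum_(l <- chains k N) g l =
    \sum_(0 <= s < N.+1) (if (s <= n)%N then 0
      else `|top 1%N s| * iter_sum (abs_weight w) (abs_base b) k.-1 2 s).
  rewrite -{1}(prednK k_gt0) sum_chainsS; apply: eq_bigr => s _; rewrite /g /=.
  case: ifP => _; first by rewrite big1.
  under eq_bigr => l _ do rewrite normrM norm_chain_weight.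
  by rewrite -mulr_sumr sum_chain_weight.
have q_ge0 : 0 <= `|q| by [].
apply: (@le_trans _ _ (\sum_(n.+1 <= s < N.+1) `|q| ^+ s.-1 * B)); last first.
  rewrite -mulr_suml; apply: ler_wpM2r; last exact: geometric_tail.
  exact: le_trans (abs_iter_sum_ge0 _ _ _ _ _) (hB 0%N).
have h s : (if (s <= n)%N then 0 else `|top 1%N s| * iter_sum (abs_weight w) (abs_base b) k.-1 2 s)
   <= (if (s <= n)%N then 0 else `|q| ^+ s.-1 * B).
  case: ifP => // _; apply: ler_pM => //; first exact: abs_iter_sum_ge0.
  exact: top_weight_bound.
apply: le_trans (ler_sum _ (fun s _ => h s)) _.
have [le_Nn|lt_nN] := leqP N n.
  rewrite big_nat big1.
    rewrite sumr_ge0 // => s _; rewrite mulr_ge0 ?exprn_ge0 // (le_trans _ (hB 0%N)) //.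
    exact: abs_iter_sum_ge0.
  by move=> s /andP[_ hs]; rewrite (_ : (s <= n)%N) // -ltnS (leq_trans hs).
rewrite (big_cat_nat _ (n := n.+1)) //=; last by rewrite ltnS ltnW.
rewrite big_nat big1 ?add0r; last by move=> s /andP[_]; rewrite ltnS => ->.
by rewrite big_nat [leRHS]big_nat ler_sum // => s /andP[lt_ns _]; rewrite leqNgt lt_ns.
Qed.

Lemma has_sum_multisum : has_sum (@multisum_term R[i] k r q D) (product_side k r (size D) q).
Proof.
have [B B_ge0 hB] := tail_bound q_lt1 le_rk k_gt0 uD.
have -> : @multisum_term R[i] k r q D = fun c => head_weight (entries c).
  by apply/funext => c; exact: multisum_termE.
apply: (@has_sum_exhaust C _ _ _ chains_le (fun n => `|q| ^+ n / (1 - `|q|) * B)).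
- have -> : (fun n => \sum_(c <- chains_le n) head_weight (entries c)) =
    fun n => \sum_(0 <= s < n.+1) top 1%N s * iter_sum w b k.-1 2 s.
    apply/funext => n; rewrite sum_chains_le -{1}(prednK k_gt0) sum_chainsS.
    by apply: eq_bigr => s _; rewrite /= -mulr_sumr sum_chain_weight.
  exact: cvg_top_sum.
- have h : (fun n => `|q| ^+ n) @ \oo --> (0 : C) by apply: cvg_expC; rewrite normr_id.
  rewrite -(mul0r B) -(mul0r (1 - `|q|)^-1).
  by apply: cvgMl; apply: cvgMl.
- by move=> n J; exact: tail_le.
Qed.

End MainTheorem.

Theorem theorem1p8 (R : realType) (q : R[i]) (j r k : nat) :
  `|q| < 1 -> (1 <= k)%N -> (j + r <= k)%N ->
  has_sum (@multisum_term R[i] k r q (index_iota 1 j.+1)) (product_side k r j q)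
  /\ (forall J : {fset nat},
        #|` J|%fset = j -> (forall i : nat, i \in J -> (1 <= i <= k - r)%N) ->
        has_sum (@multisum_term R[i] k r q (enum_fset J)) (product_side k r j q)).
Proof.
move=> q_lt1 k_gt0 le_jrk; have le_rk : (r <= k)%N by lia.
split=> [|J <- hJ].
  (* The first claim is the case of the set 1, ..., j, admissible because j <= k - r. *)
  have e : size (index_iota 1 j.+1) = j by rewrite size_iota subSS subn0.
  rewrite -{2}e; apply: has_sum_multisum => //; first exact: iota_uniq.
  by move=> i; rewrite mem_index_iota; lia.
by apply: has_sum_multisum => //; exact: fset_uniq.
Qed.
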